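(* Let $s_n$ be the number of simple Cayley permutations of length $n$ and let $S(x)=\sum_{n\geq1}s_nx^n$. Then $$S(x)=2x+\frac{2x^3}{1+x}-xU(x),$$ where $U(x)$ is the unique formal power series with $B\bigl(x,U(x)\bigr)=x$, and $B(x,t)=\sum_{\omega\in\mathrm{Cay}_+}x^{|\omega|}t^{\mu(\omega)}$.
   Context: Write $[n]=\{1,\ldots,n\}$. A Cayley permutation of length $n$ is a word $\omega=w_1\cdots w_n$ of positive integers whose set of letters is $[m]$ for some $m\leq n$; equivalently a map $\omega:[n]\to[n]$, $\omega(i)=w_i$, with image $[m]$. $\mathrm{Cay}_n$ is the set of those of length $n$, $\mathrm{Cay}_+=\bigcup_{n\geq1}\mathrm{Cay}_n$, and $|\omega|$ denotes length. $\mu(\omega)=\#\{j:|\omega^{-1}(j)|=1\}$ is the number of values occurring exactly once in $\omega$. A nonempty interval of positions $I=[a,b]\subseteq[n]$ is an H-interval of $\omega\in\mathrm{Cay}_n$ if there is an interval of values $J=[c,d]$ with $\omega(I)=J$ and $\omega^{-1}(J)=I$. $\omega\in\mathrm{Cay}_n$ is simple if every H-interval of $\omega$ is a singleton or equals $[n]$. The series $B$ has the form $B(x,t)=tx+\sum_{k\geq2}B_k(t)x^k$ with $B_k(t)\in\mathbb{Z}[t]$, and there is exactly one formal power series $U(x)\in\mathbb{Z}[[x]]$ with $B(x,U(x))=x$. *)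

(* Defs.v *)
From HB Require Import structures.
From mathcomp Require Import all_boot all_order all_algebra.
From mathcomp Require Import boolp.

Set Implicit Arguments.
Unset Strict Implicit.
Unset Printing Implicit Defensive.

Import GRing.Theory.
Local Open Scope ring_scope.

(** * Formal power series *)

Record fps (R : Type) := Fps { fps_coef :> nat -> R }.

Notation "{ 'fps' R }" := (fps R) (at level 0, format "{ 'fps'  R }").

Lemma fpsP (R : Type) (f g : {fps R}) : (forall n, f n = g n) -> f = g.
Proof. by case: f g => [f] [g] /= /funext ->. Qed.

(* Equality of series is undecidable: these structures are classical. *)
HB.instance Definition _ (R : Type) := gen_eqMixin {fps R}.
HB.instance Definition _ (R : Type) := gen_choiceMixin {fps R}.

Section FpsComRing.
Variable R : comNzRingType.
Implicit Types f g h : {fps R}.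

Definition fps_const (c : R) : {fps R} := Fps (fun n => if n == 0%N then c else 0).
Definition fps_opp f : {fps R} := Fps (fun n => - f n).
Definition fps_add f g : {fps R} := Fps (fun n => f n + g n).
Definition fps_mul f g : {fps R} :=
  Fps (fun n => \sum_(i < n.+1) f i * g (n - i)%N).

Definition fpsX : {fps R} := Fps (fun n => (n == 1%N)%:R).

Fact fps_addA : associative fps_add.
Proof. by move=> f g h; apply: fpsP => n /=; rewrite addrA. Qed.
Fact fps_addC : commutative fps_add.
Proof. by move=> f g; apply: fpsP => n /=; rewrite addrC. Qed.
Fact fps_add0 : left_id (fps_const 0) fps_add.
Proof. by move=> f; apply: fpsP => n /=; rewrite if_same add0r. Qed.
Fact fps_addN : left_inverse (fps_const 0) fps_opp fps_add.
Proof. by move=> f; apply: fpsP => n /=; rewrite if_same addNr. Qed.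

HB.instance Definition _ := GRing.isZmodule.Build {fps R}
  fps_addA fps_addC fps_add0 fps_addN.

Definition fps_trunc N f : {poly R} := \poly_(i < N.+1) f i.

Lemma fps_mul_trunc N f g n : (n <= N)%N ->
  fps_mul f g n = (fps_trunc N f * fps_trunc N g)`_n.
Proof.
move=> nN; rewrite coefM; apply: eq_bigr => i _; rewrite !coef_poly !ltnS.
by rewrite (leq_trans (leq_ord i) nN) (leq_trans (leq_subr _ _) nN).
Qed.

Fact fps_mulC : commutative fps_mul.
Proof.
by move=> f g; apply: fpsP => n; rewrite !(fps_mul_trunc _ _ (leqnn n)) mulrC.
Qed.

Fact fps_mulA : associative fps_mul.
Proof.
move=> f g h; apply: fpsP => n.
pose t := fps_trunc n.
have tE u i : (i <= n)%N -> (t u)`_i = u i by move=> le; rewrite coef_poly ltnS le.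
transitivity ((t f * (t g * t h))`_n).
  rewrite coefM; apply: eq_bigr => i _.
  by rewrite tE ?leq_ord // (@fps_mul_trunc n) // leq_subr.
rewrite mulrA coefM; apply: eq_bigr => i _.
by rewrite tE ?leq_subr // (@fps_mul_trunc n) // leq_ord.
Qed.

Fact fps_mul1 : left_id (fps_const 1) fps_mul.
Proof.
move=> f; apply: fpsP => n /=; rewrite big_ord_recl /= subn0 mul1r big1 ?addr0 //.
by move=> i _; rewrite mul0r.
Qed.

Fact fps_mulDl : left_distributive fps_mul fps_add.
Proof.
move=> f g h; apply: fpsP => n /=; rewrite -big_split /=.
by apply: eq_bigr => i _; rewrite mulrDl.
Qed.

Fact fps_1neq0 : fps_const 1 != 0 :> {fps R}.
Proof.
by apply/eqP => /(congr1 (fun f : {fps R} => f 0%N)) /= /eqP; rewrite oner_eq0.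
Qed.

HB.instance Definition _ := GRing.Zmodule_isComNzRing.Build {fps R}
  fps_mulA fps_mulC fps_mul1 fps_mulDl fps_1neq0.

Lemma fps_coef0 n : (0 : {fps R}) n = 0.
Proof. by rewrite /= if_same. Qed.

Lemma fps_coef1 n : (1 : {fps R}) n = (n == 0%N)%:R.
Proof. by rewrite /=; case: eqP. Qed.

Lemma fps_coefN f n : (- f) n = - f n.
Proof. by []. Qed.

Lemma fps_coefD f g n : (f + g) n = f n + g n.
Proof. by []. Qed.

Lemma fps_coefM f g n : (f * g) n = \sum_(i < n.+1) f i * g (n - i)%N.
Proof. by []. Qed.

End FpsComRing.

Arguments fpsX {R}.

Section FpsUnitRing.
Variable R : comUnitRingType.
Implicit Types f g : {fps R}.

Definition fps_unit : pred {fps R} := fun f => f 0%N \is a GRing.unit.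

Fixpoint fps_inv_coefs f n : seq R :=
  if n is n'.+1 then
    let s := fps_inv_coefs f n' in
    rcons s (- (f 0%N)^-1 * \sum_(i < n) f i.+1 * s`_(n' - i))
  else [:: (f 0%N)^-1].

Definition fps_inv f : {fps R} :=
  if fps_unit f then Fps (fun n => (fps_inv_coefs f n)`_n) else f.

Lemma size_fps_inv_coefs f n : size (fps_inv_coefs f n) = n.+1.
Proof. by elim: n => //= n IHn; rewrite size_rcons IHn. Qed.

Lemma nth_fps_inv_coefs f n i : (i <= n)%N ->
  (fps_inv_coefs f n)`_i = (fps_inv_coefs f i)`_i.
Proof.
elim: n => [|n IHn]; first by rewrite leqn0 => /eqP->.
rewrite leq_eqVlt => /predU1P[-> // | lt_in].
by rewrite /= nth_rcons size_fps_inv_coefs lt_in IHn.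
Qed.

Fact fps_mulV : {in fps_unit, left_inverse 1 fps_inv *%R}.
Proof.
move=> f Uf; have Uf0 : f 0%N \is a GRing.unit by [].
rewrite mulrC; apply: fpsP => -[|n]; rewrite fps_coefM fps_coef1 /fps_inv.
  by rewrite big_ord1 (Uf : fps_unit f) /= divrr.
rewrite (Uf : fps_unit f) big_ord_recl subn0 /=.
rewrite nth_rcons size_fps_inv_coefs ltnn eqxx.
rewrite mulrA mulrN divrr // mulN1r; apply/eqP; rewrite addrC subr_eq0; apply/eqP.
apply: eq_bigr => i _; rewrite /bump /= add1n subSS.
by rewrite (@nth_fps_inv_coefs _ n) // leq_subr.
Qed.

Fact fps_unitP f g : g * f = 1 -> fps_unit f.
Proof.
move=> /(congr1 (fun h : {fps R} => h 0%N)).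
rewrite fps_coefM big_ord1 fps_coef1 /= => gf1.
by apply/unitrPr; exists (g 0%N); rewrite mulrC.
Qed.

Fact fps_inv_out : {in [predC fps_unit], fps_inv =1 id}.
Proof. by move=> f nUf; rewrite /fps_inv; case: ifP => // Uf; case/negP: nUf. Qed.

HB.instance Definition _ := GRing.ComNzRing_hasMulInverse.Build {fps R}
  fps_mulV fps_unitP fps_inv_out.

Lemma fps_unitE f : (f \is a GRing.unit) = (f 0%N \is a GRing.unit).
Proof. by []. Qed.

End FpsUnitRing.

(* [F(x,t) = \sum_k F_k(t) x^k], with [F_k] in [Z[t]], is encoded as a series
   with polynomial coefficients; [fps_subst F U] is
   [F(x,U(x)) = \sum_k x^k F_k(U(x))].  The terms with [k > n] do not
   contribute to the coefficient of [x^n]. *)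
Definition fps_subst (F : {fps {poly int}}) (U : {fps int}) : {fps int} :=
  Fps (fun n => \sum_(k < n.+1) (fpsX ^+ k * (map_poly intr (F k)).[U]) n).

(** * Cayley permutations *)

(* Positions and values are both indexed from 0: [1..n] becomes ['I_n]. *)
Definition Cay (n : nat) : {set {ffun 'I_n -> 'I_n}} :=
  [set w : {ffun 'I_n -> 'I_n} |
    [exists m : 'I_n.+1, w @: [set: 'I_n] == [set j : 'I_n | (j < m)%N]]].

Definition mu (n : nat) (w : {ffun 'I_n -> 'I_n}) : nat :=
  #|[set j : 'I_n | #|w @^-1: [set j]| == 1%N]|.

Definition interval (n : nat) (a b : 'I_n) : {set 'I_n} :=
  [set i : 'I_n | (a <= i <= b)%N].

(* [J] is nonempty automatically, being the image of the nonempty set [I]. *)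
Definition H_interval (n : nat) (w : {ffun 'I_n -> 'I_n}) (I : {set 'I_n}) :
  bool :=
  [&& I != set0,
      [exists a, exists b, I == interval a b] &
      [exists c, exists d,
        (w @: I == interval c d) && (w @^-1: interval c d == I)]].

Definition simple_cay (n : nat) (w : {ffun 'I_n -> 'I_n}) : bool :=
  [forall I : {set 'I_n},
    H_interval w I ==> (#|I| == 1%N) || (I == [set: 'I_n])].

Definition nb_simple (n : nat) : nat := #|[set w in Cay n | simple_cay w]|.

(* The empty word is excluded from both generating series. *)
Definition Sseries : {fps int} :=
  Fps (fun n => if n == 0%N then 0 else (nb_simple n)%:Z).

Definition Bseries : {fps {poly int}} :=
  Fps (fun n => if n == 0%N then 0 else \sum_(w in Cay n) 'X^(mu w)).

(* Main.v *)
Require Import Defs.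
From mathcomp Require Import all_boot all_order all_algebra.
From mathcomp Require Import zify ring.

(** Let V be the series whose coefficient of x^m is the sum of wt(p) over the
    Cayley permutations p of length m+1, where wt(p) = (-1)^(|p|-1) if p is
    strictly monotone, -1 if p is simple and not monotone, and 0 otherwise.
    Counting simple permutations gives S + xV = 2x + 2x^3/(1+x), so it suffices
    to prove B(x, V) = x, uniqueness of U being clear coefficientwise.

    Expanding B(x, V) replaces each letter occurring once in a Cayley permutation
    by a weighted pattern, i.e. an H-interval after inflation.  So B(x, V)
    enumerates pairs (t, T) where t is a Cayley permutation and T a tiling of t by
    singletons and H-intervals, weighted by the product of the weights of the
    tiles.  For |t| > 1 the tilings of t cancel.  If t has two adjacent entries
    forming an H-interval 12 or 21, take the leftmost such pair a, a+1: no tile of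
    nonzero weight straddles the left end of a, and moving a in or out of the tile
    starting at a+1 changes the sign.  Otherwise a shortest nontrivial H-interval
    is simple, overlaps no other tile, and is either one tile (weight -1) or cut
    into singletons (weight 1). *)

Set Implicit Arguments.
Unset Strict Implicit.
Unset Printing Implicit Defensive.

(** * Standardization of words *)

Definition rank (s : seq nat) (v : nat) : nat := count (ltn^~ v) (undup s).

Definition std (s : seq nat) : seq nat := map (rank s) s.

(** Letters start at 0, so being a Cayley permutation means that the set of letters is closed
    downwards. The empty word qualifies. *)
Definition cay (s : seq nat) : bool := all (fun v => all (mem s) (iota 0 v)) s.

Lemma cayP s : reflect (forall u v, v \in s -> u < v -> u \in s) (cay s).
Proof.
apply: (iffP allP) => [cs u v /cs/allP cv uv | cs v vs].
  by apply: cv; rewrite mem_iota.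
by apply/allP => u; rewrite mem_iota => /andP[_ uv]; apply: (cs u v).
Qed.

Lemma rankS s v : rank s v.+1 = rank s v + (v \in s).
Proof.
rewrite -mem_undup -(count_uniq_mem v (undup_uniq s)) /rank -count_predUI.
rewrite [X in _ + X](_ : _ = 0) ?addn0; last first.
  by rewrite -(count_pred0 (undup s)); apply: eq_count => x /=; lia.
by apply: eq_count => x /=; lia.
Qed.

Lemma rank_le s u v : u <= v -> rank s u <= rank s v.
Proof. by move=> uv; apply: sub_count => x /= xu; apply: leq_trans uv. Qed.

Lemma rank_lt s u v : u \in s -> u < v -> rank s u < rank s v.
Proof. by move=> us /(rank_le s); apply: leq_trans; rewrite rankS us addn1. Qed.

Lemma rank_size s v : rank s v <= size s.
Proof. exact: leq_trans (count_size _ _) (size_undup s). Qed.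

Lemma rank_map (f : nat -> nat) s v :
  {in s &, {homo f : x y / x < y}} -> v \in s -> rank (map f s) (f v) = rank s v.
Proof.
move=> fm vs.
have fmE : {in s &, {mono f : x y / x < y}}.
  move=> x y xs ys; case: (ltngtP x y) => [xy | yx | ->]; last by rewrite ltnn.
    exact: fm.
  by apply/negbTE; rewrite -leqNgt; apply/ltnW/fm.
have finj : {in undup s &, injective f}.
  move=> x y; rewrite !mem_undup => xs ys exy.
  have := fmE _ _ xs ys; have := fmE _ _ ys xs; rewrite exy ltnn; lia.
have pu : perm_eq (undup (map f s)) (map f (undup s)).
  apply: uniq_perm; rewrite ?undup_uniq ?map_inj_in_uniq ?undup_uniq // => x.
  by rewrite mem_undup; apply/mapP/mapP => -[y ys ->]; exists y;
    rewrite ?mem_undup // -mem_undup.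
rewrite /rank (permP pu) count_map; apply: eq_in_count => x.
by rewrite mem_undup => xs /=; rewrite fmE.
Qed.

Lemma std_map (f : nat -> nat) s :
  {in s &, {homo f : x y / x < y}} -> std (map f s) = std s.
Proof.
by move=> fm; rewrite /std -map_comp; apply/eq_in_map => v vs /=; apply: rank_map.
Qed.

Lemma size_std s : size (std s) = size s.
Proof. exact: size_map. Qed.

Lemma cay_rank s v : cay s -> v \in s -> rank s v = v.
Proof.
move=> /cayP cs vs; rewrite -{2}(size_iota 0 v) /rank -size_filter.
apply/perm_size/uniq_perm; rewrite ?filter_uniq ?undup_uniq ?iota_uniq // => u.
rewrite mem_filter mem_undup mem_iota /= add0n andbC.
by case: (ltnP u v) => uv; rewrite ?andbF ?andbT // (cs u v).
Qed.

Lemma std_id s : cay s -> std s = s.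
Proof.
move=> cs; rewrite -[RHS]map_id; apply/eq_in_map => v vs; exact: cay_rank.
Qed.

(** Discrete intermediate values: as v grows from 0, the rank starts at 0 and increases by one
    exactly when v passes a letter of s. *)
Lemma rank_onto s v r : r < rank s v -> exists2 u, u \in s & rank s u = r.
Proof.
elim: v => [|v IHv]; first by rewrite /rank; rewrite (eq_count (a2 := pred0)) ?count_pred0.
rewrite rankS; case vs: (v \in s); last by rewrite addn0.
by rewrite addn1 ltnS leq_eqVlt => /predU1P[-> | /IHv //]; exists v.
Qed.

Lemma cay_std s : cay (std s).
Proof.
apply/cayP => r _ /mapP[v vs ->] /rank_onto[u us <-]; exact: map_f.
Qed.

(** The v + 1 distinct letters from 0 to v all occur in s. *)
Lemma cay_bound s v : cay s -> v \in s -> v < size s.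
Proof.
move=> /cayP cs vs; rewrite -[v.+1](size_iota 0); apply: uniq_leq_size => [|u].
  exact: iota_uniq.
by rewrite mem_iota add0n /= ltnS leq_eqVlt => /predU1P[-> | ] //; apply: cs.
Qed.

(* Equality of the comparison patterns forces the two words to standardize
   identically: the letterwise correspondence is an increasing function. *)
Lemma std_eq s t : size s = size t ->
  (forall i j, i < size s -> j < size s ->
     (nth 0 s i < nth 0 s j) = (nth 0 t i < nth 0 t j)) ->
  std s = std t.
Proof.
move=> est cmp.
pose f v := nth 0 t (index v s).
have ix v : v \in s -> index v s < size s by rewrite index_mem.
have -> : t = map f s.
  apply: (@eq_from_nth _ 0) => [|i]; rewrite ?size_map // -est => i_s.
  rewrite (nth_map 0) // /f.
  have ji : index (nth 0 s i) s < size s by rewrite ix ?mem_nth.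
  have ej : nth 0 s (index (nth 0 s i) s) = nth 0 s i by rewrite nth_index ?mem_nth.
  by have := cmp _ _ i_s ji; have := cmp _ _ ji i_s; rewrite ej ltnn; lia.
apply/esym/std_map => u v us vs uv.
by rewrite /f -cmp ?ix // !nth_index.
Qed.

(** * Weighted compositions of an interval *)

Section Tilings.
Import GRing.Theory.
Local Open Scope ring_scope.
Variable w : nat -> nat -> int.

(** The fuel m makes the recursion on the first piece structural. Each piece has length at least
    one, so j - i units suffice, and running out then means i = j, the empty composition. *)
Fixpoint tsum_fuel (m i j : nat) : int :=
  if m is m'.+1 then
    if i == j then 1 else \sum_(i.+1 <= k < j.+1) w i k * tsum_fuel m' k j
  else 1.

(* The sum, over all ways of cutting [i, j[ into consecutive nonempty
   intervals [a, b[, of the product of the weights [w a b]. *)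
Definition tsum (i j : nat) : int := tsum_fuel (j - i) i j.

Lemma tsum_fuelE m i j : (j - i <= m)%N -> (i <= j)%N -> tsum_fuel m i j = tsum i j.
Proof.
rewrite /tsum; elim/ltn_ind: m i j => m IHm i j ijm ij.
case: m => [|m] in ijm IHm *; first by have -> : (j - i = 0)%N by lia.
have [-> | nij] := eqVneq i j; first by rewrite subnn /= eqxx.
have -> : (j - i = (j - i.+1).+1)%N by lia.
rewrite /= (negPf nij); apply: eq_big_nat => k /andP[ik kj].
rewrite IHm; [|lia..]; congr (_ * _).
by case: (ltnP (j - i.+1) m) => [lt|ge]; [rewrite IHm //; lia|
  rewrite (_ : (j - i.+1)%N = m) ?IHm //; lia].
Qed.

Lemma tsum_id i : tsum i i = 1.
Proof. by rewrite /tsum subnn. Qed.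

Lemma tsumE i j : (i < j)%N -> tsum i j = \sum_(i.+1 <= k < j.+1) w i k * tsum k j.
Proof.
move=> ij; rewrite {1}/tsum (_ : (j - i = (j - i.+1).+1)%N) /=; last by lia.
rewrite ltn_eqF //; apply: eq_big_nat => k /andP[ik kj].
by rewrite tsum_fuelE //; lia.
Qed.

(** When no piece of nonzero weight straddles c, every contributing composition has a cut at c, so
    the sum factors. The induction peels off the first piece on the left of c. *)
Lemma tsum_cut i c j : (i <= c)%N -> (c <= j)%N ->
    (forall a b, (i <= a < c)%N -> (c < b <= j)%N -> w a b = 0) ->
  tsum i j = tsum i c * tsum c j.
Proof.
move: {2}(c - i)%N (leqnn (c - i)) => d; elim: d i => [|d IHd] i.
  by move=> di ic cj _; rewrite (_ : i = c) ?tsum_id ?mul1r //; lia.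
move=> di ic cj w0; have [-> | nic] := eqVneq i c; first by rewrite tsum_id mul1r.
rewrite tsumE; last by lia.
rewrite [tsum i c]tsumE; last by lia.
rewrite (@big_cat_nat _ _ _ c.+1) /=; [|lia..].
rewrite [X in _ + X]big_nat_cond [X in _ + X]big1 => [|k /andP[k1 _]]; last first.
  by rewrite w0 ?mul0r //; lia.
rewrite addr0 mulr_suml; apply: eq_big_nat => k k1.
rewrite -mulrA IHd //; [lia..|] => a b ab bj; apply: w0; lia.
Qed.

(** Sign-reversing pairing: a composition starting with the singleton at a followed by [a+1, k[
    cancels against the one where these two pieces are merged. *)
Lemma tsum_shift a j : (a.+1 < j)%N -> w a a.+1 = 1 ->
  (forall k, (a.+1 < k <= j)%N -> w a k = - w a.+1 k) -> tsum a j = 0.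
Proof.
move=> aj w1 wN; rewrite tsumE; last by lia.
rewrite big_ltn; last by lia.
rewrite w1 mul1r tsumE // -big_split big_nat /= big1 // => k k1.
by rewrite wN ?mulNr ?addrN //; lia.
Qed.

(** Only two compositions survive: the whole interval, with weight -1, and the one into singletons,
    with weight 1. *)
Lemma tsum_simple a b : (a.+1 < b)%N -> w a b = -1 ->
  (forall i k, (a <= i < k)%N -> (k <= b)%N -> (k - i < b - a)%N ->
     w i k = (k == i.+1)%:R) ->
  tsum a b = 0.
Proof.
move=> ab wab ws.
(* Once the start has left a, the whole interval is out of reach and only the cutting into
   singletons remains. *)
have t1 i : (a < i <= b)%N -> tsum i b = 1.
  move: {2}(b - i)%N (leqnn (b - i)) => d; elim: d i => [|d IHd] i di ai.
    by rewrite (_ : i = b) ?tsum_id //; lia.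
  have [-> | nic] := eqVneq i b; first by rewrite tsum_id.
  rewrite tsumE; last by lia.
  rewrite big_ltn; last by lia.
  rewrite IHd; [|lia..]; rewrite ws; [|lia..].
  rewrite eqxx mul1r big_nat big1 ?addr0 // => k k1.
  by rewrite ws; [rewrite gtn_eqF ?mul0r //; lia|lia..].
rewrite tsumE; last by lia.
rewrite big_ltn; last by lia.
rewrite t1; last by lia.
rewrite ws; [|lia..]; rewrite eqxx mul1r big_nat_recr /=; last by lia.
rewrite wab tsum_id mulr1 big_nat big1 ?add0r ?addrN // => k k1.
by rewrite ws; [rewrite gtn_eqF ?mul0r //; lia|lia..].
Qed.

End Tilings.

(** * H-intervals of words *)

Definition separates (r s : seq nat) : bool :=
  all (fun v => all (ltn v) s || all (gtn v) s) r.

Definition seg (t : seq nat) (i k : nat) : seq nat := drop i (take k t).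

(* For Cayley permutations, being an H-interval only depends on comparisons:
   no letter outside of the interval lies between two letters inside of it,
   nor equals one of them. *)
Definition hint (t : seq nat) (i k : nat) : bool :=
  separates (take i t ++ drop k t) (seg t i k).

Definition mono (p : seq nat) : bool := sorted ltn p || sorted gtn p.

Definition simple (p : seq nat) : bool :=
  all (fun i => all (fun k => (i < k) && hint p i k ==>
      (k == i.+1) || ((i == 0) && (k == size p)))
    (iota 0 (size p).+1)) (iota 0 (size p).+1).

(** Form of [hint] in terms of positions, so that overlaps reduce to linear arithmetic on
    indices. *)
Definition hintp (t : seq nat) (i k : nat) : Prop :=
  forall j, j < size t -> (j < i) || (k <= j) ->
    (forall l, i <= l < k -> nth 0 t j < nth 0 t l) \/
    (forall l, i <= l < k -> nth 0 t l < nth 0 t j).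

Lemma size_seg t i k : k <= size t -> size (seg t i k) = k - i.
Proof. by move=> kt; rewrite size_drop size_take_min; congr (_ - _); lia. Qed.

Lemma nth_seg t i k l : l < k - i -> nth 0 (seg t i k) l = nth 0 t (i + l).
Proof. by move=> lt; rewrite nth_drop nth_take //; lia. Qed.

Lemma hintP t i k : i <= k <= size t -> reflect (hintp t i k) (hint t i k).
Proof.
move=> /andP[ik kt].
have segA (a : pred nat) :
    reflect (forall l, i <= l < k -> a (nth 0 t l)) (all a (seg t i k)).
  apply: (iffP (all_nthP 0)); rewrite size_seg // => H l lk.
    have lki : l - i < k - i by lia.
    by have := H _ lki; rewrite nth_seg // subnKC //; lia.
  by rewrite nth_seg //; apply: H; lia.
apply: (iffP allP) => H.
  move=> j jt jik.
  have /H/orP[/segA ?|/segA ?] : nth 0 t j \in take i t ++ drop k t; [|by left|by right].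
  rewrite mem_cat; case: (ltnP j i) jik => [ji _ | _ /= kj]; apply/orP.
    by left; rewrite -(nth_take 0 ji) mem_nth // size_take_min leq_min ji.
  by right; rewrite -(subnKC kj) -nth_drop mem_nth // size_drop ltn_sub2r // (leq_ltn_trans kj).
move=> v; rewrite mem_cat => /orP[] /(nthP 0)[j].
  rewrite size_take_min leq_min => /andP[ji jt] <-; rewrite nth_take //.
  by have [|?|?] := H _ jt; rewrite ?ji //; apply/orP; [left|right]; apply/segA.
rewrite size_drop => ji <-; rewrite nth_drop.
have kjt : k + j < size t by rewrite -ltn_subRL.
have [|?|?] := H _ kjt; first by rewrite leq_addr orbT.
  by apply/orP; left; apply/segA.
by apply/orP; right; apply/segA.
Qed.

Lemma simpleP p : reflect
  (forall i k, i < k <= size p -> hintp p i k -> k = i.+1 \/ i = 0 /\ k = size p)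
  (simple p).
Proof.
apply: (iffP allP) => H.
  move=> i k ikp hp; have /H/allP/(_ k) : i \in iota 0 (size p).+1.
    by rewrite mem_iota; lia.
  rewrite mem_iota (_ : _ && _) //=; last by lia.
  have -> : i < k by lia.
  by have -> /= : hint p i k; [apply/hintP => //; lia | lia].
move=> i; rewrite mem_iota => ip; apply/allP => k; rewrite mem_iota => kp.
apply/implyP => /andP[ik /hintP hp].
by have [||->|[-> ->]] := H i k; rewrite ?eqxx ?orbT //; [lia|apply: hp; lia].
Qed.

Lemma sorted_ltn_seg (r : rel nat) t i k : transitive r -> k <= size t ->
  reflect (forall j l, i <= j -> j < l -> l < k -> r (nth 0 t j) (nth 0 t l))
    (sorted r (seg t i k)).
Proof.
move=> rT kt; apply: (iffP idP) => [sr j l ij jl lk | H].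
  have := sorted_ltn_nth rT 0 sr; rewrite /prop_in2 /= => /(_ (j - i) (l - i)).
  by rewrite !inE !size_seg // !nth_seg ?subnKC; [apply; lia|lia..].
apply/(sortedP 0) => j; rewrite size_seg // => jk.
by rewrite !nth_seg; [apply: H; lia|lia..].
Qed.

Lemma seg_full t : seg t 0 (size t) = t.
Proof. by rewrite /seg take_size drop0. Qed.

Definition monop (t : seq nat) (i k : nat) : Prop :=
  (forall j l, i <= j -> j < l -> l < k -> nth 0 t j < nth 0 t l) \/
  (forall j l, i <= j -> j < l -> l < k -> nth 0 t l < nth 0 t j).

Lemma monoP t i k : k <= size t -> reflect (monop t i k) (mono (seg t i k)).
Proof.
move=> kt; apply: (iffP orP) => -[H|H]; [left|right|left|right].
- exact/(sorted_ltn_seg _ ltn_trans kt).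
- have gtnT : transitive gtn by move=> a b c /= ab ca; apply: ltn_trans ab.
  exact/(sorted_ltn_seg _ gtnT kt).
- exact/(sorted_ltn_seg _ ltn_trans kt).
- have gtnT : transitive gtn by move=> a b c /= ab ca; apply: ltn_trans ab.
  exact/(sorted_ltn_seg _ gtnT kt).
Qed.

(** * Overlapping H-intervals: intersections, differences, unions *)

Section Overlap.
Variable t : seq nat.
Local Notation n := (size t).
Local Notation x := (nth 0 t).

Lemma hintpI i k i' k' : i <= i' -> k <= k' ->
  hintp t i k -> hintp t i' k' -> hintp t i' k.
Proof.
move=> ii kk H H' j jn jik; have [jo|ji] := boolP ((j < i) || (k <= j)).
  by have [r|r] := H _ jn jo; [left|right] => l lk; apply: r; lia.
have [|r|r] := H' _ jn; [lia|left|right] => l lk; apply: r; lia.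
Qed.

(** The delicate positions j are those of the overlap. Position k serves as a witness: it is outside
    the first interval, hence on one side of all of it, and inside the second, so that each l in [i,
    i'[ compares with j as it does with k. *)
Lemma hintp_diffl i k i' k' : i < i' -> i' < k -> k < k' -> k' <= n ->
  hintp t i k -> hintp t i' k' -> hintp t i i'.
Proof.
move=> ii ik kk kn H H' j jn jii; have [jo|ji] := boolP ((j < i) || (k <= j)).
  by have [r|r] := H _ jn jo; [left|right] => l lk; apply: r; lia.
have [||r|r] := H k; [lia|lia|left|right] => l lk.
  have [||r'|r'] := H' l; [lia|lia| |by apply: r'; lia].
  by have := r l; have := r' k; lia.
have [||r'|r'] := H' l; [lia|lia|by apply: r'; lia|].
by have := r l; have := r' k; lia.
Qed.

Lemma hintp_diffr i k i' k' : i < i' -> i' < k -> k < k' -> k' <= n ->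
  hintp t i k -> hintp t i' k' -> hintp t k k'.
Proof.
move=> ii ik kk kn H H' j jn jii; have [jo|ji] := boolP ((j < i') || (k' <= j)).
  by have [r|r] := H' _ jn jo; [left|right] => l lk; apply: r; lia.
have [||r|r] := H' i; [lia|lia|left|right] => l lk.
  have [||r'|r'] := H l; [lia|lia| |by apply: r'; lia].
  by have := r l; have := r' i; lia.
have [||r'|r'] := H l; [lia|lia|by apply: r'; lia|].
by have := r l; have := r' i; lia.
Qed.

(** The common position i' forces an outer letter to be on the same side of both intervals. *)
Lemma hintpU i k i' k' : i <= i' -> i' < k -> k <= k' ->
  hintp t i k -> hintp t i' k' -> hintp t i k'.
Proof.
move=> ii ik kk H H' j jn jik.
have [||r|r] := H j; [lia|lia|left|right] => l lk.
all: case: (ltnP l k) => lk'; first by apply: r; lia.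
all: have [||r'|r'] := H' j; [lia|lia| |]; last first.
all: try by apply: r'; lia.
all: by have := r i'; have := r' i'; lia.
Qed.

Lemma hintp_mono i k i' k' : hintp t i k -> monop t i k -> i <= i' -> k' <= k ->
  hintp t i' k'.
Proof.
move=> H M ii kk j jn jik; have [jo|ji] := boolP ((j < i) || (k <= j)).
  by have [r|r] := H _ jn jo; [left|right] => l lk; apply: r; lia.
case: (ltnP j i') jik => [jl _|_ /= jr]; case: M => M.
- by left => l lk; apply: M; lia.
- by right => l lk; apply: M; lia.
- by right => l lk; apply: M; lia.
- by left => l lk; apply: M; lia.
Qed.

Lemma monop_sub i k i' k' : monop t i k -> i <= i' -> k' <= k -> monop t i' k'.
Proof. by move=> [M|M] ii kk; [left|right] => j l *; apply: M; lia. Qed.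

Lemma hintp_full : hintp t 0 n.
Proof. by move=> j jn; lia. Qed.

(* Two adjacent entries forming the pattern 12 or 21. *)
Definition pairp a := hintp t a a.+2 /\ x a <> x a.+1.

Lemma pair_mono a : x a <> x a.+1 -> monop t a a.+2.
Proof.
move=> xa; case: (ltnP (x a) (x a.+1)) => xaS; [left|right] => j l ja jl la.
  by have [-> ->] : j = a /\ l = a.+1 by lia.
by have [-> ->] : j = a /\ l = a.+1; lia.
Qed.

Lemma mono_pair i k a : hintp t i k -> monop t i k -> i <= a -> a.+1 < k -> pairp a.
Proof.
move=> H M ia ak; split; first exact: (hintp_mono H M).
by case: M => M; have := M a a.+1; lia.
Qed.

(** A two-letter H-interval may also repeat one letter; this is excluded as soon as one of its
    positions is an H-interval by itself. *)
Lemma pair_of_hintp a : hintp t a a.+2 -> a.+1 < n ->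
  hintp t a a.+1 \/ hintp t a.+1 a.+2 -> pairp a.
Proof.
move=> H an [] Ha; split=> //.
  by have [||r|r] := Ha a.+1; [lia|lia| |]; have := r a; lia.
by have [||r|r] := Ha a; [lia|lia| |]; have := r a.+1; lia.
Qed.

End Overlap.

(** * Cancellation of the weighted tilings *)

Section Weights.
Import GRing.Theory.
Local Open Scope ring_scope.

Definition wt (p : seq nat) : int :=
  if mono p then (-1) ^+ (size p).-1 else if simple p then -1 else 0.

Definition wint (t : seq nat) (i k : nat) : int :=
  if (k == i.+1) || hint t i k then wt (seg t i k) else 0.

Definition simplep (t : seq nat) (i k : nat) : Prop :=
  forall i' k', (i <= i' < k')%N -> (k' <= k)%N -> hintp t i' k' ->
    k' = i'.+1 \/ i' = i /\ k' = k.

(** Positions outside the H-interval [i, k[ are already separated from all of it, so only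
    comparisons inside the factor matter. *)
Lemma hintp_seg t i k i' k' : (i <= i' < k')%N -> (k' <= k <= size t)%N ->
  hintp t i k -> hintp (seg t i k) (i' - i) (k' - i) <-> hintp t i' k'.
Proof.
move=> ii kk H; have kn : (k <= size t)%N by lia.
split=> H' j.
  move=> jn jo; have [jo'|ji] := boolP ((j < i) || (k <= j))%N.
    by have [r|r] := H _ jn jo'; [left|right] => l lk; apply: r; lia.
  have [||r|r] := H' (j - i)%N; [rewrite size_seg; lia|lia|left|right] => l lk.
    by have := r (l - i)%N; rewrite !nth_seg ?subnKC; [apply; lia|lia..].
  by have := r (l - i)%N; rewrite !nth_seg ?subnKC; [apply; lia|lia..].
rewrite size_seg // => jn jo.
have [||r|r] := H' (i + j)%N; [lia|lia|left|right] => l lk.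
  by rewrite !nth_seg; [apply: r; lia|lia..].
by rewrite !nth_seg; [apply: r; lia|lia..].
Qed.

Lemma simple_segP t i k : (i <= k <= size t)%N -> hintp t i k ->
  reflect (simplep t i k) (simple (seg t i k)).
Proof.
move=> ikt H; have kt : (k <= size t)%N by lia.
apply: (iffP (simpleP _)); rewrite size_seg // => S i' k' ii.
  move=> kk /(hintp_seg ii _ H) H'.
  by have [||e|[e1 e2]] := S (i' - i)%N (k' - i)%N; [lia|apply: H'; lia|lia|lia].
move=> H'; have [|||e|[e1 e2]] := S (i + i')%N (i + k')%N; [lia|lia| |lia|lia].
by apply/(hintp_seg _ _ H); rewrite ?addKn //; lia.
Qed.

Section Vanishing.
Variable t : seq nat.
Local Notation n := (size t).
Local Notation x := (nth 0%N t).

Lemma wint1 i : (i < n)%N -> wint t i i.+1 = 1.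
Proof.
move=> it; rewrite /wint eqxx /wt; case: ifP => [_|/negP[]].
  by rewrite size_seg // subSn // subnn.
by apply/monoP => //; left; lia.
Qed.

Lemma wint_neq0 i k : (i < k <= n)%N -> wint t i k != 0 ->
  k = i.+1 \/ hintp t i k /\ (monop t i k \/ simplep t i k).
Proof.
move=> ikn; have kn : (k <= n)%N by lia.
have [->|nk] := eqVneq k i.+1; first by left.
rewrite /wint (negPf nk) /=; case: ifP; last by rewrite eqxx.
move=> /hintP H; have {}H : hintp t i k by apply: H; lia.
rewrite /wt; case: ifP => [/(monoP _ kn) M _|_]; first by right; split; [|left].
case: ifP; last by rewrite eqxx.
move=> /simple_segP S _; right; split=> //; right; apply: S => //; lia.
Qed.

Lemma wint_mono i k : (i < k <= n)%N -> hintp t i k -> monop t i k ->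
  wint t i k = (-1) ^+ (k - i).-1.
Proof.
move=> ikn H M; have kn : (k <= n)%N by lia.
rewrite /wint (_ : hint t i k) ?orbT; last by apply/hintP => //; lia.
by rewrite /wt (_ : mono _) ?size_seg //; apply/monoP.
Qed.

Lemma wint_simple i k : (i < k <= n)%N -> hintp t i k -> ~ monop t i k ->
  simplep t i k -> wint t i k = -1.
Proof.
move=> ikn H M S; have kn : (k <= n)%N by lia.
rewrite /wint (_ : hint t i k) ?orbT; last by apply/hintP => //; lia.
rewrite /wt (_ : mono _ = false); last by apply/negP => /(monoP _ kn).
by rewrite (_ : simple _) //; apply/simple_segP => //; lia.
Qed.

(** A monotone tile across the left end of a would create a pair at a - 1. A simple tile cannot
    contain the whole pair as a proper H-interval. There remains k = a + 1: then the part [i, a[ is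
    an H-interval, hence a singleton, and the tile itself is an earlier pair. *)
Lemma no_cross_pair a i k : pairp t a -> (forall b, (b < a)%N -> ~ pairp t b) ->
  (a.+1 < n)%N -> (i < a)%N -> (a < k <= n)%N -> wint t i k = 0.
Proof.
move=> Pa amin an ia akn; apply/eqP/negPn/negP => /wint_neq0[|e|[H MS]]; try lia.
have noM : ~ monop t i k.
  by move=> M; apply: (amin a.-1); [lia | apply: (mono_pair H M); lia].
case: MS => // S; have [H2 _] := Pa.
have [k_a|ka] := leqP k a.+1.
  have {k_a} ek : k = a.+1 by lia.
  have Hd : hintp t i a by apply: (@hintp_diffl t i k a a.+2) => //; lia.
  have [|||e|[_ e]] := S i a; [lia|lia|by []| |lia].
  have Hc : hintp t a a.+1.
    by rewrite -ek; apply: (hintpI _ _ H H2); lia.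
  apply: (amin i) => //; apply: pair_of_hintp; [|lia|right]; rewrite -?e //.
  by rewrite -ek.
by have [||||] := S a a.+2; [lia|lia|by []|lia|lia].
Qed.

(** For k = a + 2 the two weights are -1 and 1. For larger k, if either weight is nonzero then both
    tiles are monotone H-intervals, and their lengths differ by one. *)
Lemma wint_shift a k : pairp t a -> (a.+1 < k <= n)%N ->
  wint t a k = - wint t a.+1 k.
Proof.
move=> [H2 xa] ak; have M2 := pair_mono xa.
have [ek|nek] := eqVneq k a.+2.
  rewrite ek wint1 ?wint_mono //; [|lia..].
  by rewrite (_ : (a.+2 - a).-1 = 1)%N ?expr1 //; lia.
have up : hintp t a k /\ monop t a k -> wint t a k = - wint t a.+1 k.
  move=> [H M]; have M' : monop t a.+1 k by apply: (monop_sub M).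
  have H' : hintp t a.+1 k by apply: (hintp_mono H M).
  rewrite !wint_mono //; [|lia..].
  by rewrite (_ : (k - a).-1 = (k - a.+1).-1.+1)%N ?exprS ?mulN1r //; lia.
have [ea|ea] := eqVneq (wint t a k) 0; last first.
  move: (ea) => /wint_neq0[|e|[H [M|S]]]; [lia|lia|by apply: up|].
  by have [||||] := S a a.+2; [lia|lia|by []|lia|lia].
have [ea'|ea'] := eqVneq (wint t a.+1 k) 0; first by rewrite ea ea' oppr0.
move: (ea') => /wint_neq0[|e|[H MS]]; [lia|lia|].
(* If [a+1, k[ is simple, removing the overlap with the pair leaves the H-interval [a+2, k[, which
   must be a singleton; the tile then has two distinct letters and is monotone anyway. *)
have M : monop t a.+1 k.
  case: MS => // S.
  have Hd : hintp t a.+2 k by apply: (@hintp_diffr t a a.+2 a.+1 k) => //; lia.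
  have [||||[]] := S a.+2 k; [lia|lia|by []| |lia] => ek.
  have ek' : k = a.+3 by [].
  rewrite ek'; apply: pair_mono.
  by have [] : pairp t a.+1
    by apply: pair_of_hintp; [rewrite -ek'|lia|right; rewrite -ek'].
apply: up; split; first by apply: (@hintpU t a a.+2 a.+1 k) => //; lia.
(* Entry a is on one side of [a+1, k[ and entry a + 2 on one side of the pair; together they fix the
   direction of the monotone tile, which therefore extends to a. *)
have [||ra|ra] := H a; [lia|lia| |].
  have [||r|r] := H2 a.+2; [lia|lia| |].
    by have := r a; have := ra a.+2; lia.
  case: M => M; last by have := M a.+1 a.+2; have := r a.+1; lia.
  by left=> j l ja jl lk; have [->|ne] := eqVneq j a; [apply: ra|apply: M]; lia.
have [||r|r] := H2 a.+2; [lia|lia| |]; last first.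
  by have := r a; have := ra a.+2; lia.
case: M => M; first by have := M a.+1 a.+2; have := r a.+1; lia.
by right=> j l ja jl lk; have [->|ne] := eqVneq j a; [apply: ra|apply: M]; lia.
Qed.

Lemma tsum_pair a : pairp t a -> (a.+1 < n)%N ->
  (forall b, (b < a)%N -> ~ pairp t b) -> tsum (wint t) 0 n = 0.
Proof.
move=> Pa an amin; rewrite (@tsum_cut _ _ a) //; [|lia|] => [|b k ba ak].
  by rewrite (@tsum_shift _ a n) ?mulr0 ?wint1 //; [lia|] => k ak; apply: wint_shift.
by apply: (@no_cross_pair a) => //; lia.
Qed.

Lemma tsum_no_pair : (1 < n)%N -> (forall a, (a.+1 < n)%N -> ~ pairp t a) ->
  tsum (wint t) 0 n = 0.
Proof.
move=> n1 nop.
have nomono i k : (i.+1 < k <= n)%N -> hintp t i k -> ~ monop t i k.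
  by move=> ikn H M; apply: (nop i); [lia | apply: (mono_pair H M); lia].
pose P d := has (fun a => (1 < d)%N && (a + d <= n)%N && hint t a (a + d)%N) (iota 0 n.+1).
(* The whole word is an H-interval of length n > 1, so a least length d exists. *)
have exP : exists d, P d.
  exists n; apply/hasP; exists 0%N; rewrite ?mem_iota // add0n n1 leqnn /=.
  apply/hintP; [lia | exact: hintp_full].
have [d Pd dmin] := ex_minnP exP.
have {Pd} [a [d1 adn Had]] : exists a : nat, [/\ 1 < d, a + d <= n & hint t a (a + d)]%N.
  by have /hasP[a _ /andP[/andP[d1 adn] Had]] := Pd; exists a.
move/hintP: Had => Had.
have {}Had : hintp t a (a + d)%N by apply: Had; lia.
have short i k : (i < k <= n)%N -> (k - i < d)%N -> hintp t i k -> k = i.+1.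
  move=> ikn kid H; have [//|nk] := eqVneq k i.+1.
  suff /dmin : P (k - i)%N by lia.
  apply/hasP; exists i; first by rewrite mem_iota; lia.
  rewrite subnKC; last by lia.
  by apply/andP; split; [lia | apply/hintP => //; lia].
have [b eb] : exists b, b = (a + d)%N by exists (a + d)%N.
rewrite -eb in adn Had.
have S : simplep t a b.
  move=> i k aik kb H; have [kid|dki] := ltnP (k - i)%N d; last by right; lia.
  by left; apply: short => //; lia.
have wab : wint t a b = -1 by apply: wint_simple => //; [lia | apply: nomono => //; lia].
(* A simple tile cannot properly contain [a, b[. A partial overlap cuts [a, b[ into two shorter
   H-intervals, both singletons by minimality of d, so [a, b[ would be a pair. *)
have cross i k : (i < k <= n)%N -> wint t i k != 0 ->
    (i < a < k)%N || (i < b < k)%N -> False.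
  move=> ikn /wint_neq0[//|e|[H MS]] ib; first by lia.
  case: MS => [/nomono|Sik]; first by apply=> //; lia.
  have [sub|nsub] := boolP ((i <= a) && (b <= k))%N.
    by have [||||] := Sik a b; [lia|lia|by []|lia|lia].
  have [ia|ai] := ltnP i a.
    have kb : (k < b)%N by lia.
    have H1 : hintp t a k.
      by apply: (hintpI _ _ H Had); lia.
    have H2 : hintp t k b by apply: (@hintp_diffr t i k a b) => //; lia.
    have e1 : k = a.+1 by apply: short => //; lia.
    have e2 : b = k.+1 by apply: short => //; lia.
    apply: (nop a); first by lia.
    by apply: pair_of_hintp; [|lia|left]; rewrite -e1 // -e2.
  have ai' : (a < i)%N by lia.
  have H1 : hintp t i b.
    by apply: (hintpI _ _ Had H); lia.
  have H2 : hintp t a i by apply: (@hintp_diffl t a b i k) => //; lia.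
  have e1 : i = a.+1 by apply: short => //; lia.
  have e2 : b = i.+1 by apply: short => //; lia.
  apply: (nop a); first by lia.
  by apply: pair_of_hintp; [|lia|left]; rewrite -e1 // -e2.
rewrite (@tsum_cut _ _ a) //; [|lia|] => [|i k ia ak]; last first.
  by apply/eqP/negPn/negP => /cross; apply; lia.
rewrite (@tsum_cut _ a b) //; [|lia|] => [|i k ia ak]; last first.
  by apply/eqP/negPn/negP => /cross; apply; lia.
rewrite (@tsum_simple _ a b) ?mul0r ?mulr0 //; first by lia.
move=> i k aik kb kid; have [->|nk] := eqVneq k i.+1; first by rewrite wint1 //; lia.
apply/eqP/negPn/negP => /wint_neq0[|e|[H _]]; [lia|lia|].
have ek : k = i.+1 by apply: short => //; lia.
by rewrite ek eqxx in nk.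
Qed.

Lemma tsum_vanish : (1 < n)%N -> tsum (wint t) 0 n = 0.
Proof.
move=> n1.
pose P a := (a.+1 < n)%N && hint t a a.+2 && (x a != x a.+1).
have PP a : (a.+1 < n)%N -> reflect (pairp t a) (P a).
  move=> an; rewrite /P an /=; apply: (iffP andP) => -[H xa].
    by split; [apply/hintP => //; lia | apply/eqP].
  by split; [apply/hintP => //; lia | apply/eqP].
have [/hasP[a0 _ Pa0]|/hasPn noP] := boolP (has P (iota 0 n)).
  have [a Pa amin] := ex_minnP (ex_intro (fun a => is_true (P a)) a0 Pa0).
  have an : (a.+1 < n)%N by case/andP: Pa => /andP[].
  apply: (@tsum_pair a) => //; first exact/PP.
  by move=> b ba /PP Pb; have := amin b (Pb _); lia.
apply: tsum_no_pair => // a an /(PP _ an); apply/negP/noP.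
by rewrite mem_iota; lia.
Qed.

End Vanishing.
End Weights.

(** * Inflation *)

Definition all_below (s s' : seq nat) : bool := all (fun v => all (ltn v) s') s.

Lemma all_belowP s s' :
  reflect (forall u v, u \in s -> v \in s' -> u < v) (all_below s s').
Proof.
apply: (iffP allP) => [H u v /H/allP us /us // | H u us].
by apply/allP => v vs; apply: H.
Qed.

(* The tilings of a word by singletons and H-intervals: equal segments at
   different places can only be equal letters. *)
Definition tiling (ss : seq (seq nat)) : bool :=
  all (fun s => all (fun s' => (s == s') || all_below s s' || all_below s' s) ss) ss
  && all (fun s => (1 < count_mem s ss) ==> (size s == 1)) ss.

Lemma tilingP ss : reflect
  ((forall s s', s \in ss -> s' \in ss -> s <> s' -> all_below s s' \/ all_below s' s)
   /\ (forall s, 1 < count_mem s ss -> size s = 1))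
  (tiling ss).
Proof.
apply: (iffP andP) => -[H1 H2]; split.
- move=> s s' sI s'I /eqP ne; have /allP/(_ _ sI)/allP/(_ _ s'I) := H1.
  by rewrite (negPf ne) /= => /orP.
- move=> s cs; have sI : s \in ss by rewrite -has_pred1 has_count; lia.
  by have /allP/(_ _ sI) := H2; rewrite cs => /eqP.
- apply/allP => s sI; apply/allP => s' s'I; have [//|/eqP ne] := eqVneq s s'.
  by apply/orP; apply: H1.
- by apply/allP => s sI; apply/implyP => /H2/eqP.
Qed.

(** Distinct blocks of a tiling are comparable as a whole, so any letter can represent its block;
    the first one is taken. *)
Definition quotient_word (ss : seq (seq nat)) : seq nat := std (map (head 0) ss).

Definition decompose (ss : seq (seq nat)) : seq nat * seq (seq nat) :=
  (quotient_word ss, map std ss).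

(* The letter [v] of the [i]-th pattern is first encoded as the pair [(o_i, v)],
   ordered lexicographically; [N] bounds the letters of all patterns. *)
Definition raw_inflation (N : nat) (o : seq nat) (ps : seq (seq nat)) :=
  [seq map (addn (cp.1 * N)) cp.2 | cp <- zip o ps].

Definition inflation N o ps : seq (seq nat) :=
  let raw := raw_inflation N o ps in map (map (rank (flatten raw))) raw.

(** Combinatorial meaning of substituting for t in B(x,t): only letters counted by [mu] are open to
    inflation. *)
Definition inflatable (o : seq nat) (ps : seq (seq nat)) : bool :=
  all (fun cp => (count_mem cp.1 o == 1) || (cp.2 == [:: 0])) (zip o ps).

(** * From tilings to quotients and patterns *)

Section Decompose.
Variables (N : nat) (ss : seq (seq nat)).
Hypotheses (ssT : tiling ss) (ss0 : [::] \notin ss) (ssN : all (fun s => size s < N) ss).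

Let heads := map (head 0) ss.

Let seg_neq s s' : s \in ss -> s' \in ss -> s <> s' -> all_below s s' \/ all_below s' s.
Proof. by case/tilingP: ssT => H _; apply: H. Qed.

Let head_mem s : s \in ss -> head 0 s \in s.
Proof. by case: s => [|v s]; [rewrite (negPf ss0) | rewrite mem_head]. Qed.

Let seg_uniq s s' v : s \in ss -> s' \in ss -> v \in s -> v \in s' -> s = s'.
Proof.
move=> sI s'I vs vs'; apply/eqP/negPn/negP => /eqP ne.
by have [/all_belowP/(_ v v vs vs')|/all_belowP/(_ v v vs' vs)] := seg_neq sI s'I ne;
  rewrite ltnn.
Qed.

Let block v := nth [::] ss (find (fun s => v \in s) ss).

Let blockE s v : s \in ss -> v \in s -> block v = s.
Proof.
move=> sI vs; have hv : has (fun s => v \in s) ss by apply/hasP; exists s.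
by apply: (@seg_uniq _ _ v); rewrite ?mem_nth ?(nth_find [::] hv) // -has_find.
Qed.

Let g v := rank heads (head 0 (block v)) * N + rank (block v) v.

(** Re-inflating the decomposition replaces each letter v by [g v], its block rank followed by its
    rank inside the block. As [g] is increasing on the letters of the tiling, the standardization is
    unchanged. *)
Lemma flatten_decompose :
  std (flatten (raw_inflation N (decompose ss).1 (decompose ss).2)) = std (flatten ss).
Proof.
have -> : raw_inflation N (decompose ss).1 (decompose ss).2 = map (map g) ss.
  rewrite /raw_inflation /decompose /quotient_word /std /= -map_comp zip_map -map_comp.
  apply/eq_in_map => s sI /=; rewrite -map_comp; apply/eq_in_map => v vs /=.
  by rewrite /g (blockE sI vs).
rewrite -map_flatten; apply: std_map => u v /flattenP[s sI us] /flattenP[s' s'I vs] uv.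
rewrite /g (blockE sI us) (blockE s'I vs).
have rN : rank s u < N by apply: leq_ltn_trans (rank_size _ _) (allP ssN _ sI).
have [e|/eqP ne] := eqVneq s s'.
  by rewrite -e ltn_add2l; apply: rank_lt.
have [lt|/all_belowP/(_ _ _ vs us)] := seg_neq sI s'I ne; last by lia.
have : rank heads (head 0 s) < rank heads (head 0 s').
  by apply: rank_lt; [exact: map_f | move/all_belowP: lt; apply; apply: head_mem].
by nia.
Qed.

(** Blocks sharing a letter coincide, so a repeated letter of the quotient comes from a repeated
    block, which [tiling] forces to be a singleton. *)
Lemma decompose_inflatable : inflatable (decompose ss).1 (decompose ss).2.
Proof.
have rank_inj : {in heads &, injective (rank heads)}.
  move=> u v uh vh e; have := @rank_lt heads u v uh; have := @rank_lt heads v u vh.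
  by rewrite e ltnn; lia.
rewrite /inflatable /decompose /quotient_word /= [std (map _ _)]/std -map_comp zip_map.
rewrite all_map; apply/allP => s sI /=.
have [le1|gt1] := leqP (count_mem s ss) 1; apply/orP; last first.
  have [_ /(_ _ gt1) s1] := tilingP _ ssT; right.
  by case: s s1 {sI gt1} => [|v []] //= _; rewrite /std /= /rank /= ltnn.
left; rewrite eqn_leq; apply/andP; split; last first.
  rewrite -has_count has_pred1; exact: map_f.
apply: leq_trans le1; rewrite count_map -/heads.
rewrite (@eq_in_count _ _ (pred1 s)) // => s' s'I /=.
apply/eqP/eqP => [|-> //] /rank_inj e.
have {}e : head 0 s' = head 0 s by apply: e; apply: map_f.
by apply: (@seg_uniq _ _ (head 0 s)) => //; [rewrite -e|]; apply: head_mem.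
Qed.

End Decompose.

(** The decomposition determines the underlying word, which is Cayley and hence its own
    standardization, and the block lengths, which are those of the patterns. *)
Lemma decompose_inj N ss ss' :
    tiling ss -> [::] \notin ss -> all (fun s => size s < N) ss -> cay (flatten ss) ->
    tiling ss' -> [::] \notin ss' -> all (fun s => size s < N) ss' -> cay (flatten ss') ->
  decompose ss = decompose ss' -> ss = ss'.
Proof.
move=> T z b c T' z' b' c' e; apply: eq_from_flatten_shape.
  rewrite -(std_id c) -(std_id c') -(flatten_decompose T z b).
  by rewrite -(flatten_decompose T' z' b') e.
have shapeE r : shape r = shape (decompose r).2.
  by rewrite /shape -map_comp; apply: eq_map => s; rewrite /= size_std.
by rewrite shapeE e -shapeE.
Qed.

Lemma count_mem_gt1 (s : seq nat) i j : i < j < size s -> nth 0 s i = nth 0 s j ->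
  1 < count_mem (nth 0 s i) s.
Proof.
move=> /andP[ij js] e; rewrite -{2}(cat_take_drop j s) count_cat -addn1 leq_add //.
  rewrite -has_count has_pred1 -(nth_take 0 ij); apply: mem_nth.
  by rewrite size_take js.
by rewrite -has_count has_pred1 e (drop_nth 0 js) mem_head.
Qed.

Lemma tiling_map (f : nat -> nat) ss : [::] \notin ss ->
  {in flatten ss &, {homo f : x y / x < y}} -> tiling ss -> tiling (map (map f) ss).
Proof.
move=> ss0 fm /tilingP[T1 T2].
have inF s v : s \in ss -> v \in s -> v \in flatten ss by move=> *; apply/flattenP; exists s.
have below s s' : s \in ss -> s' \in ss -> all_below s s' -> all_below (map f s) (map f s').
  move=> sI s'I /all_belowP H; apply/all_belowP => _ _ /mapP[u us ->] /mapP[v vs ->].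
  by apply: fm; [apply: (inF s) | apply: (inF s') | apply: H].
apply/tilingP; split.
  move=> _ _ /mapP[s sI ->] /mapP[s' s'I ->] ne.
  have /(T1 _ _ sI s'I)[/below|/below] : s <> s' by move=> e; apply: ne; rewrite e.
    by left; auto.
  by right; auto.
move=> r cr; have /mapP[s sI er] : r \in map (map f) ss by rewrite -has_pred1 has_count; lia.
rewrite er size_map; apply: T2; apply: leq_trans cr _.
rewrite count_map er (@eq_in_count _ _ (pred1 s)) // => s' s'I /=.
apply/eqP/eqP => [e | -> //]; apply/eqP/negPn/negP => /eqP ne.
have [v vs] : exists v, v \in s by case: (s) sI => [|v ?]; [rewrite (negPf ss0)|exists v; rewrite mem_head].
have fvs : f v \in map f s by apply: map_f.
by have [/below|/below] := T1 _ _ s'I sI ne => /(_ _ _)/all_belowP/(_ (f v) (f v));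
  rewrite e ltnn; auto.
Qed.

(** * From quotients and patterns back to tilings *)

Section Inflation.
Variables (N : nat) (o : seq nat) (ps : seq (seq nat)).
Hypotheses (szE : size o = size ps) (oC : cay o) (psC : all cay ps).
Hypotheses (ps0 : [::] \notin ps) (psN : all (all (gtn N)) ps) (oP : inflatable o ps).

Local Notation raw := (raw_inflation N o ps).

Let size_raw : size raw = size o.
Proof. by rewrite size_map size_zip szE minnn. Qed.

Let nth_raw i : i < size o ->
  nth [::] raw i = map (addn (nth 0 o i * N)) (nth [::] ps i).
Proof.
move=> io; rewrite (nth_map (0, [::])) ?nth_zip //.
by rewrite size_zip -szE minnn.
Qed.

Let nth_ps_neq0 i : i < size o -> nth [::] ps i <> [::].
Proof. by move=> io e; case/negP: ps0; rewrite -e mem_nth // -szE. Qed.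

Let nth_ps_lt i v : i < size o -> v \in nth [::] ps i -> v < N.
Proof.
move=> io vi; have /allP/(_ _ vi) // : all (gtn N) (nth [::] ps i).
by apply: (allP psN); rewrite mem_nth // -szE.
Qed.

Let nth_ps_single i : i < size o -> count_mem (nth 0 o i) o != 1 ->
  nth [::] ps i = [:: 0].
Proof.
move=> io ne; have /allP/(_ (nth (0, [::]) (zip o ps) i)) := oP.
rewrite mem_nth ?size_zip -?szE ?minnn // nth_zip //= => /(_ isT)/orP[e|/eqP//].
by rewrite e in ne.
Qed.

Let nth_ps_dup i j : i < size o -> j < size o -> i <> j -> nth 0 o i = nth 0 o j ->
  nth [::] ps i = [:: 0].
Proof.
move=> io jo ij e; apply: nth_ps_single => //.
suff : 1 < count_mem (nth 0 o i) o by lia.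
case: (ltngtP i j) => // lt; first by apply: (@count_mem_gt1 o i j) => //; rewrite lt.
by rewrite e; apply: (@count_mem_gt1 o j i) => //; rewrite lt.
Qed.

Let raw0 : [::] \notin raw.
Proof.
apply/negP => /(nthP [::])[i]; rewrite size_raw => io; rewrite nth_raw // => e.
apply: (nth_ps_neq0 io); apply/nilP; rewrite /nilp -(size_map (addn (nth 0 o i * N))).
by rewrite e.
Qed.

(** Pattern letters are below N, so blocks over different letters of [o] lie in disjoint ranges.
    Equal letters of [o] at different positions both carry the pattern [[:: 0]] and give equal
    blocks. *)
Let raw_tiling : tiling raw.
Proof.
apply/tilingP; split.
  move=> _ _ /(nthP [::])[i ir <-] /(nthP [::])[j jr <-].
  rewrite size_raw in ir jr; rewrite !nth_raw // => ne.
  have ij : i <> j by move=> ij; apply: ne; rewrite ij.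
  have below a b : a < size o -> b < size o -> nth 0 o a < nth 0 o b ->
      all_below (map (addn (nth 0 o a * N)) (nth [::] ps a))
        (map (addn (nth 0 o b * N)) (nth [::] ps b)).
    move=> ao bo ab; apply/all_belowP => _ _ /mapP[u ua ->] /mapP[v vb ->].
    by have := nth_ps_lt ao ua; nia.
  case: (ltngtP (nth 0 o i) (nth 0 o j)) => [lt|lt|e].
  - by left; apply: below.
  - by right; apply: below.
  case: ne; rewrite (nth_ps_dup ir jr ij e) (nth_ps_dup jr ir _ (esym e)) ?e //.
  exact: nesym.
move=> s cs; have /(nthP [::])[i ir es] : s \in raw by rewrite -has_pred1 has_count; lia.
rewrite size_raw in ir; rewrite nth_raw // in es; rewrite -es size_map.
have [e1|ne1] := eqVneq (count_mem (nth 0 o i) o) 1; last by rewrite nth_ps_single.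
(* A block determines its letter of [o] by division by N, so it cannot be repeated more often than
   that letter. *)
suff : count_mem s raw <= count_mem (nth 0 o i) o by lia.
have -> : count_mem (nth 0 o i) o = count (fun cp => cp.1 == nth 0 o i) (zip o ps).
  by rewrite -(count_map fst (pred1 _)) -/(unzip1 _) unzip1_zip ?szE.
rewrite count_map (@eq_in_count _ _
  (fun cp => (map (addn (cp.1 * N)) cp.2 == s) && (cp.1 == nth 0 o i))).
  by apply: sub_count => cp /andP[].
move=> cp /(nthP (0, [::]))[j]; rewrite size_zip szE minnn -szE => jo <-.
rewrite nth_zip //=; case: eqP => //= e; apply/esym/eqP.
have [v vi] : exists v, v \in nth [::] ps i.
  by have := nth_ps_neq0 ir; case: (nth [::] ps i) => // v ? _; exists v; rewrite mem_head.
have /mapP[u uj euv] : nth 0 o i * N + v \in map (addn (nth 0 o j * N)) (nth [::] ps j).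
  by rewrite e -es map_f.
by have := nth_ps_lt ir vi; have := nth_ps_lt jo uj; nia.
Qed.

Let rk_mono : {in flatten raw &, {homo rank (flatten raw) : x y / x < y}}.
Proof. by move=> x y xr _; apply: rank_lt. Qed.

Lemma inflation_flatten : flatten (inflation N o ps) = std (flatten raw).
Proof. by rewrite /inflation -map_flatten. Qed.

Lemma inflation_tiling : tiling (inflation N o ps).
Proof. exact: tiling_map. Qed.

Lemma inflation_neq0 : [::] \notin inflation N o ps.
Proof.
apply/negP => /mapP[s sI e]; case/negP: raw0; rewrite (_ : [::] = s) //.
by apply/esym/nilP; rewrite /nilp -(size_map (rank (flatten raw))) -e.
Qed.

Lemma inflation_shape : shape (inflation N o ps) = shape ps.
Proof.
rewrite /shape -map_comp -map_comp -[in RHS](@unzip2_zip _ _ o ps) ?szE // -map_comp.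
by apply: eq_map => cp; rewrite /= !size_map.
Qed.

(** Standardizing a block forgets the ranking and the shift by a multiple of N, both increasing. The
    heads compare like the letters of [o], with equality preserved because repeated letters carry
    the same pattern. *)
Lemma decompose_inflation : decompose (inflation N o ps) = (o, ps).
Proof.
have inF s v : s \in raw -> v \in s -> v \in flatten raw by move=> *; apply/flattenP; exists s.
congr pair; last first.
  rewrite /inflation -map_comp -[RHS](@unzip2_zip _ _ o ps) ?szE //.
  transitivity (map std raw).
    apply/eq_in_map => s sI; apply: std_map => u v us vs.
    by apply: rk_mono; apply: (inF s).
  rewrite /raw_inflation -map_comp; apply/eq_in_map => cp /(nthP (0, [::]))[j].
  rewrite size_zip szE minnn => jo <- /=; rewrite nth_zip //=.
  rewrite std_map => [|u v _ _ uv]; last by rewrite ltn_add2l.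
  by apply: std_id; apply: (allP psC); apply: mem_nth.
rewrite /quotient_word -[RHS](std_id oC).
have -> : map (head 0) (inflation N o ps) = map (rank (flatten raw)) (map (head 0) raw).
  rewrite /inflation -map_comp -[RHS]map_comp; apply/eq_in_map => s sI /=.
  by case: s sI => // sI; case/negP: raw0.
rewrite std_map; last first.
  have hF v : v \in map (head 0) raw -> v \in flatten raw.
    case/mapP=> s sI ->; apply: (inF s) => //.
    by case: s sI => [|u s] sI; [case/negP: raw0 | rewrite mem_head].
  by move=> u v /hF us /hF vs; apply: rk_mono.
apply: std_eq; rewrite size_map size_raw // => i j io jo.
rewrite !(nth_map [::]) ?size_raw // !nth_raw //.
have headE k : k < size o ->
    let h := head 0 (nth [::] ps k) in
    h < N /\ head 0 (map (addn (nth 0 o k * N)) (nth [::] ps k)) = nth 0 o k * N + h.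
  move=> ko; have := nth_ps_neq0 ko; have := @nth_ps_lt k ^~ ko.
  by case: (nth [::] ps k) => //= v ? H _; split=> //; apply: H; rewrite mem_head.
have [hi ->] := headE i io; have [hj ->] := headE j jo.
case: (ltngtP (nth 0 o i) (nth 0 o j)) => [||e]; [nia..|].
rewrite e ltn_add2l; have [-> | /eqP ij] := eqVneq i j; first by rewrite ltnn.
by rewrite (nth_ps_dup io jo) // (nth_ps_dup jo io) // => ?; apply: ij.
Qed.

End Inflation.

(** * Splittings of a word *)

Section Splits.
Import GRing.Theory.
Local Open Scope ring_scope.

Fixpoint splits (m : nat) (s : seq nat) : seq (seq (seq nat)) :=
  if m is m'.+1 then
    if s is [::] then [:: [::]]
    else [seq take k s :: ss | k <- iota 1 (size s), ss <- splits m' (drop k s)]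
  else [:: [::]].

Lemma splitsS m s : s <> [::] -> splits m.+1 s =
  [seq take k s :: ss | k <- iota 1 (size s), ss <- splits m (drop k s)].
Proof. by case: s. Qed.

Lemma mem_splits m s ss : (size s <= m)%N ->
  (ss \in splits m s) = (flatten ss == s) && ([::] \notin ss).
Proof.
have nilE ss' : (ss' \in [:: [::]]) = (flatten ss' == [::] :> seq nat) && ([::] \notin ss').
  by rewrite inE; case: ss' => [|[|y r] ss'] //=; rewrite ?inE andbF.
elim: m s ss => [|m IHm] s ss sm.
  by move: sm; rewrite leqn0 => /nilP->; apply: nilE.
have [->|/eqP s0] := eqVneq s [::]; first exact: nilE.
rewrite splitsS //; apply/idP/idP => [/allpairsPdep[k [ss' [kI]]] | /andP[/eqP e n0]].
  have {}kI : (0 < k <= size s)%N by move: kI; rewrite mem_iota; lia.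
  rewrite IHm; last by rewrite size_drop; lia.
  move=> /andP[/eqP e n0] ->; rewrite [flatten _]/= e cat_take_drop eqxx inE negb_or n0.
  by rewrite andbT; case: k kI {e} => //; case: (s) s0.
case: ss e n0 => [/esym // |r ss] /= e; rewrite inE negb_or => /andP[r0 n0].
apply/allpairsPdep; exists (size r), ss.
have sr : (0 < size r <= size s)%N.
  by rewrite -e size_cat leq_addr andbT; case: r r0 {e}.
split; first by rewrite mem_iota add1n ltnS.
  have ed : drop (size r) s = flatten ss by rewrite -e drop_size_cat.
  by rewrite IHm ed ?eqxx // -ed size_drop; lia.
by rewrite -e take_size_cat.
Qed.

Lemma uniq_splits m s : uniq (splits m s).
Proof.
elim: m s => [//|m IHm] s; have [->//|/eqP s0] := eqVneq s [::]; rewrite splitsS //.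
have take_inj (a b : nat) : a \in iota 1 (size s) -> b \in iota 1 (size s) ->
    take a s = take b s -> a = b.
  by rewrite !mem_iota => ai bi /(congr1 size); rewrite !size_takel; lia.
apply: allpairs_uniq_dep => [|k _|[k ss] [k' ss']]; [exact: iota_uniq | exact: IHm|].
move=> /allpairsPdep[k1 [ss1 [k1I _ [-> ->]]]] /allpairsPdep[k2 [ss2 [k2I _ [-> ->]]]].
by move=> [/take_inj-> // ->].
Qed.

Fixpoint wprod (t : seq nat) (i : nat) (ss : seq (seq nat)) : int :=
  if ss is s :: ss' then wint t i (i + size s)%N * wprod t (i + size s)%N ss' else 1.

Lemma sum_wprod m t i : (size t - i <= m)%N -> (i <= size t)%N ->
  \sum_(ss <- splits m (drop i t)) wprod t i ss = tsum_fuel (wint t) m i (size t).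
Proof.
elim: m i => [|m IHm] i im it; first by rewrite big_seq1.
rewrite [RHS]/=; have [e|ne] := eqVneq i (size t).
  by rewrite e drop_size big_seq1.
have sd : size (drop i t) = (size t - i)%N by rewrite size_drop.
rewrite splitsS; last by move=> e; move: sd; rewrite e /=; lia.
rewrite big_allpairs_dep sd.
(* [splits] chooses the length of the first block, [tsum_fuel] its end position k. *)
have -> : iota 1 (size t - i) = map (fun k => (k - i)%N) (index_iota i.+1 (size t).+1).
  apply: (@eq_from_nth _ 0%N) => [|j]; rewrite ?size_map !size_iota ?subSS // => jt.
  by rewrite (nth_map 0%N) ?size_iota ?subSS // !nth_iota ?subSS //; lia.
rewrite big_map; apply: eq_big_nat => k /andP[ik kt].
rewrite drop_drop subnK; last by lia.
rewrite -IHm; [|lia..]; rewrite mulr_sumr; apply: eq_bigr => ss _ /=.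
rewrite size_take_min sd (_ : (i + minn _ _)%N = k) //; lia.
Qed.

Lemma segmentE a s b :
  seg (flatten (a ++ s :: b)) (size (flatten a)) (size (flatten a) + size s) = s.
Proof.
by rewrite flatten_cat /= /seg catA -size_cat take_size_cat // drop_size_cat.
Qed.

Lemma wint_segment a s b : (0 < size s)%N ->
  wint (flatten (a ++ s :: b)) (size (flatten a)) (size (flatten a) + size s) =
  if (size s == 1%N) || separates (flatten (a ++ b)) s then wt s else 0.
Proof.
move=> s0; rewrite /wint segmentE -addn1 eqn_add2l /hint segmentE flatten_cat /=.
rewrite take_size_cat // catA -size_cat drop_size_cat //.
by rewrite flatten_cat.
Qed.

(** The prefix [a] of blocks already passed is kept general, so that the induction on [b] can move
    one block across. *)
Lemma wprod_cat a b : [::] \notin b ->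
  wprod (flatten (a ++ b)) (size (flatten a)) b = \prod_(i < size b)
    (let s := nth [::] b i in
     if (size s == 1%N) || separates (flatten (a ++ take i b ++ drop i.+1 b)) s
     then wt s else 0).
Proof.
elim: b a => [|s b IHb] a /=; first by rewrite big_ord0.
rewrite inE negb_or => /andP[s0 b0]; rewrite big_ord_recl /= drop0; congr (_ * _).
  by rewrite wint_segment //; case: s s0.
have -> : a ++ s :: b = (a ++ [:: s]) ++ b by rewrite -catA.
have -> : (size (flatten a) + size s = size (flatten (a ++ [:: s])))%N.
  by rewrite flatten_cat /= cats0 size_cat.
rewrite IHb //; apply: eq_bigr => i _ /=.
by rewrite -!catA.
Qed.

(** Turns the pairwise condition of [tiling] into a condition on each block against the rest of the
    word, which is what [wint] tests. *)
Lemma tiling_separates ss : [::] \notin ss ->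
  tiling ss = [forall i : 'I_(size ss), (size (nth [::] ss i) == 1%N) ||
    separates (flatten (take i ss ++ drop i.+1 ss)) (nth [::] ss i)].
Proof.
move=> ss0; apply/idP/forallP => [/tilingP[T1 T2] i | H].
  apply/orP; have [|s1] := eqVneq (size (nth [::] ss i)) 1%N; [by left | right].
  have iss := ltn_ord i; set s := nth [::] ss i in s1 *.
  have sI : s \in ss by apply: mem_nth.
  have c1 : (count_mem s ss <= 1)%N by rewrite leqNgt; apply/negP => /T2 /eqP; rewrite (negPf s1).
  have sN : s \notin take i ss ++ drop i.+1 ss.
    rewrite -has_pred1 has_count count_cat; move: c1.
    by rewrite -{1}(cat_take_drop i ss) (drop_nth [::]) // count_cat /= -/s eqxx; lia.
  apply/allP => v /flattenP[s' s'I vs'].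
  have ne : s <> s' by move=> e; rewrite e s'I in sN.
  have s'ss : s' \in ss.
    by move: s'I; rewrite mem_cat => /orP[/mem_take | /mem_drop].
  have [/all_belowP lt|/all_belowP lt] := T1 _ _ sI s'ss ne; apply/orP; [right|left];
    by apply/allP => u us; apply: lt.
have sep i : (i < size ss)%N -> size (nth [::] ss i) <> 1%N -> forall j, (j < size ss)%N -> i <> j ->
    forall v, v \in nth [::] ss j -> (forall u, u \in nth [::] ss i -> (v < u)%N) \/
      (forall u, u \in nth [::] ss i -> (u < v)%N).
  move=> iss /eqP s1 j jss ij v vj; have := H (Ordinal iss); rewrite /= (negPf s1) /=.
  move=> /allP/(_ v); have -> : v \in flatten (take i ss ++ drop i.+1 ss).
    apply/flattenP; exists (nth [::] ss j) => //; rewrite mem_cat.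
    have [ji|ij'] := ltnP j i.
      by rewrite -(nth_take _ ji) mem_nth // size_take iss.
    have {ij'}ij' : (i < j)%N by lia.
    by rewrite -[in X in _ || X](subnKC ij') -nth_drop mem_nth ?orbT // size_drop ltn_sub2r // (leq_ltn_trans ij').
  by move=> /(_ isT)/orP[/allP|/allP]; [left|right].
apply/tilingP; split.
  move=> _ _ /(nthP [::])[i iss <-] /(nthP [::])[j jss <-] ne.
  have ij : i <> j by move=> ij; apply: ne; rewrite ij.
  (* Singletons escape the hypothesis: two of them are compared directly, and one facing a longer
     block gets its side from that block. *)
  have D a b : (a < size ss)%N -> (b < size ss)%N -> a <> b -> nth [::] ss a <> nth [::] ss b ->
      forall v, v \in nth [::] ss b -> (forall u, u \in nth [::] ss a -> (v < u)%N) \/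
      (forall u, u \in nth [::] ss a -> (u < v)%N).
    move=> ass bss ab neab v vb.
    have [a1|/eqP a1] := eqVneq (size (nth [::] ss a)) 1%N; last exact: (sep a ass a1 b bss ab v vb).
    have [b1|/eqP b1] := eqVneq (size (nth [::] ss b)) 1%N.
      case: (nth _ _ a) a1 neab => [|u []] // _; case: (nth _ _ b) b1 vb => [|w []] // _.
      rewrite inE => /eqP-> ne'; case: (ltngtP w u) => [lt|lt|e]; [left|right|by case: ne'; rewrite e].
        by move=> u'; rewrite inE => /eqP->.
      by move=> u'; rewrite inE => /eqP->.
    have := sep b bss b1 a ass (nesym ab).
    case: (nth _ _ a) a1 => [|u []] // _ /(_ u (mem_head _ _))[lt|lt]; [right|left].
      by move=> u'; rewrite inE => /eqP->; apply: lt.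
    by move=> u'; rewrite inE => /eqP->; apply: lt.
  have Dij := D i j iss jss ij ne; have Dji := D j i jss iss (nesym ij) (nesym ne).
  have [v0 v0j] : exists v, v \in nth [::] ss j.
    have := mem_nth [::] jss; case: (nth _ _ j) => [|v r] ?; first by case/negP: ss0.
    by exists v; rewrite mem_head.
  (* Each letter of either block is on one side of the other block, so the side of [v0] decides for
     all letters. *)
  case: (Dij v0 v0j) => lt0; [right|left]; apply/all_belowP.
    move=> v u vj ui; case: (Dij v vj) => [|lt]; first exact.
    have := lt u ui; have := lt0 u ui.
    by case: (Dji u ui) => lt'; [have := lt' v0 v0j | have := lt' v vj]; lia.
  move=> u v ui vj; case: (Dij v vj) => [lt|]; last exact.
  have := lt u ui; have := lt0 u ui.
  by case: (Dji u ui) => lt'; [have := lt' v vj | have := lt' v0 v0j]; lia.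
(* A repeated block of length other than one would have to be separated from a copy of itself. *)
move=> s cs; apply/eqP/negPn/negP => /eqP s1.
have sI : s \in ss by rewrite -has_pred1 has_count; lia.
have iss : (index s ss < size ss)%N by rewrite index_mem.
have es : nth [::] ss (index s ss) = s by rewrite nth_index.
have := H (Ordinal iss); rewrite /= es => /orP[/eqP/s1 //|/allP sepS].
have [v vs] : exists v, v \in s.
  by case: s sI {cs s1 iss es sepS} => [|v r] ?; [case/negP: ss0|exists v; rewrite mem_head].
have : v \in flatten (take (index s ss) ss ++ drop (index s ss).+1 ss).
  apply/flattenP; exists s => //; rewrite -has_pred1 has_count count_cat.
  move: cs; rewrite -{1}(cat_take_drop (index s ss) ss) (drop_nth [::]) // count_cat /= es eqxx; lia.
by move=> /sepS/orP[/allP/(_ v vs)|/allP/(_ v vs)] /=; rewrite ltnn.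
Qed.

Lemma wprod_tiling ss : [::] \notin ss ->
  wprod (flatten ss) 0 ss = if tiling ss then \prod_(s <- ss) wt s else 0.
Proof.
move=> ss0; rewrite (@wprod_cat [::]) //= tiling_separates //.
case: ifP => [/forallP H|/negbT].
  rewrite (big_nth [::]) big_mkord; apply: eq_bigr => i _.
  by rewrite H.
rewrite negb_forall => /existsP[i /negbTE H].
by rewrite (bigD1 i) //= H mul0r.
Qed.

Lemma sum_tilings t : (0 < size t)%N ->
  \sum_(ss <- splits (size t) t | tiling ss) \prod_(s <- ss) wt s = (size t == 1%N)%:R.
Proof.
move=> t0; transitivity (tsum (wint t) 0 (size t)).
  rewrite /tsum subn0 -sum_wprod ?subn0 // drop0 big_mkcond /=.
  apply: eq_big_seq => ss; rewrite mem_splits // => /andP[/eqP <- n0].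
  by rewrite wprod_tiling.
move: t0; rewrite leq_eqVlt => /predU1P[/esym e|t1]; last first.
  by rewrite tsum_vanish // gtn_eqF.
by rewrite e tsumE // big_nat1 tsum_id wint1 ?e ?mulr1.
Qed.

End Splits.

(** * Cayley permutations as words *)

Definition word n (w : {ffun 'I_n -> 'I_n}) : seq nat := [seq val (w i) | i <- enum 'I_n].

Definition cayw n : seq (seq nat) := [seq word w | w <- enum (Cay n)].

Lemma size_word n (w : {ffun 'I_n -> 'I_n}) : size (word w) = n.
Proof. by rewrite size_map size_enum_ord. Qed.

Lemma nth_word n (w : {ffun 'I_n -> 'I_n}) (i : 'I_n) : nth 0 (word w) i = w i.
Proof. by rewrite (nth_map i) ?size_enum_ord // nth_ord_enum. Qed.

Lemma word_inj n : injective (@word n).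
Proof. 
move=> w w' e; apply/ffunP => i; apply: val_inj.
by have := congr1 (fun s => nth 0 s i) e; rewrite !nth_word. Qed.

Lemma mem_word n (w : {ffun 'I_n -> 'I_n}) (v : nat) :
  reflect (exists i, v = w i) (v \in word w).
Proof.
apply: (iffP mapP) => [[i _ ->] | [i ->]]; first by exists i.
by exists i; rewrite ?mem_enum.
Qed.

Lemma Cay_word n (w : {ffun 'I_n -> 'I_n}) : (w \in Cay n) = cay (word w).
Proof.
rewrite inE; apply/existsP/cayP => [[m /eqP im] u _ /mem_word[i ->] ui | cw].
  have : w i \in [set j : 'I_n | j < m] by rewrite -im imset_f.
  rewrite inE => wm; have un : u < n by apply: ltn_trans ui _.
  have : Ordinal un \in w @: [set: 'I_n] by rewrite im inE /=; apply: ltn_trans wm.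
  by case/imsetP => j _ e; apply/mem_word; exists j; rewrite -e.
(* The bound m is one more than the largest letter, and 0 for the empty word. *)
have mn : \max_(i < n) (w i).+1 < n.+1 by rewrite ltnS; apply/bigmax_leqP => i _.
exists (Ordinal mn); apply/eqP/setP => j; rewrite inE /=.
apply/imsetP/idP => [[i _ ->] | jm]; first exact: (leq_bigmax (F := fun i => (w i).+1)).
have [/existsP[i ji]|/existsPn H] := boolP [exists i, j < (w i).+1]; last first.
  by move: jm; rewrite ltnNge => /negP[]; apply/bigmax_leqP => i _; rewrite leqNgt.
have /mem_word[k ek] : (j : nat) \in word w.
  move: ji; rewrite ltnS leq_eqVlt => /predU1P[-> | ji]; first by apply/mem_word; exists i.
  by apply: cw ji; apply/mem_word; exists i.
by exists k; [rewrite inE | apply: val_inj].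
Qed.

Lemma mem_cayw n s : (s \in cayw n) = (size s == n) && cay s.
Proof.
apply/mapP/andP => [[w] | [/eqP sn cs]].
  by rewrite mem_enum Cay_word => cw ->; rewrite size_word.
pose w : {ffun 'I_n -> 'I_n} := [ffun i : 'I_n => insubd i (nth 0 s i)].
have ws : word w = s.
  apply: (@eq_from_nth _ 0); rewrite size_word ?sn // => i i_n.
  rewrite (nth_word w (Ordinal i_n)) ffunE insubdK // -topredE /= -sn.
  by apply: cay_bound; rewrite // mem_nth // sn.
by exists w => //; rewrite mem_enum Cay_word ws.
Qed.

Lemma uniq_cayw n : uniq (cayw n).
Proof. by rewrite map_inj_uniq ?enum_uniq //; apply: word_inj. Qed.

Lemma count_word n (w : {ffun 'I_n -> 'I_n}) (v : 'I_n) :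
  count_mem (v : nat) (word w) = #|w @^-1: [set v]|.
Proof.
rewrite count_map cardE [in RHS]/enum_mem size_filter enumT.
by apply: eq_count => i; rewrite /= !inE.
Qed.

(** Counting positions instead of values is harmless here, since each value concerned has exactly
    one position. *)
Lemma mu_word n (w : {ffun 'I_n -> 'I_n}) :
  mu w = count (fun c => count_mem c (word w) == 1) (word w).
Proof.
set s := word w; rewrite -size_filter /mu cardE -(size_map val).
apply/perm_size/uniq_perm.
- by rewrite map_inj_uniq ?enum_uniq //; apply: val_inj.
- apply: count_mem_uniq => v; rewrite mem_filter.
  rewrite count_filter; case: eqP => /= [v1|v1].
    rewrite (@eq_count _ _ (pred1 v)) => [|u /=]; last first.
      by case: eqP => // ->; rewrite v1 eqxx.
    by rewrite v1 -has_pred1 has_count v1.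
  apply/eqP; rewrite -leqn0 leqNgt -has_count; apply/hasPn => u _ /=.
  by apply/negP => /andP[/eqP-> /eqP].
move=> v; rewrite mem_filter; apply/mapP/andP => [[u] | [/eqP v1 /mem_word[i ei]]].
  rewrite mem_enum inE -count_word => c1 ->; split=> //.
  by rewrite -has_pred1 has_count (eqP c1).
by exists (w i) => //; rewrite mem_enum inE -count_word -ei v1.
Qed.

Lemma H_interval_word n (w : {ffun 'I_n -> 'I_n}) (a b : 'I_n) :
    w \in Cay n -> a <= b ->
  H_interval w (Defs.interval a b) = hint (word w) a b.+1.
Proof.
rewrite Cay_word => /cayP cw ab; have wE := nth_word w.
have intP (c d i : 'I_n) : (i \in Defs.interval c d) = (c <= i <= d) by rewrite inE.
have aI : a \in Defs.interval a b by rewrite intP leqnn.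
have hP : reflect (hintp (word w) a b.+1) (hint (word w) a b.+1).
  by apply: hintP; rewrite size_word leqW //=.
apply/and3P/hP => [[_ _ /existsP[c /existsP[d /andP[/eqP im /eqP pre]]]] | H].
  have inJ i : (c <= w i <= d) = (a <= i <= b) by rewrite -(intP a b i) -pre !inE.
  move=> j; rewrite size_word => jn jab; rewrite (wE (Ordinal jn)).
  have ji := inJ (Ordinal jn); rewrite /= in ji.
  have [wc|cw'] := ltnP (w (Ordinal jn)) c; [left|right] => l lab.
    have ln : l < n by have := ltn_ord b; lia.
    by rewrite (wE (Ordinal ln)); have := inJ (Ordinal ln); rewrite /=; lia.
  have ln : l < n by have := ltn_ord b; lia.
  by rewrite (wE (Ordinal ln)); have := inJ (Ordinal ln); rewrite /=; lia.
split; first by apply/set0Pn; exists a.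
  by apply/existsP; exists a; apply/existsP; exists b.
(* The interval of values runs from the least to the greatest letter on [a, b]. *)
pose c := w [arg min_(i < a in Defs.interval a b) w i].
pose d := w [arg max_(i > a in Defs.interval a b) w i].
have cmin i : i \in Defs.interval a b -> c <= w i.
  by move=> iI; rewrite /c; case: arg_minnP => // k _; apply.
have dmax i : i \in Defs.interval a b -> w i <= d.
  by move=> iI; rewrite /d; case: arg_maxnP => // k _; apply.
have [ci ciI ec] : exists2 i, i \in Defs.interval a b & w i = c.
  by rewrite /c; case: arg_minnP => // k kI _; exists k.
have [di diI ed] : exists2 i, i \in Defs.interval a b & w i = d.
  by rewrite /d; case: arg_maxnP => // k kI _; exists k.
have inJ i : (c <= w i <= d) = (i \in Defs.interval a b).
  apply/idP/idP => [|iI]; last by rewrite cmin ?dmax.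
  apply: contraTT => iI; have := H i; rewrite size_word ltn_ord wE => /(_ isT).
  move: iI ciI diI; rewrite !intP -ec -ed => iI ciI diI.
  by case=> [|lt|lt]; [lia| |]; have := lt ci; have := lt di; rewrite !wE; lia.
apply/existsP; exists c; apply/existsP; exists d; apply/andP; split; apply/eqP/setP => j.
  rewrite [RHS]intP; apply/imsetP/idP => [[i iI ->] | jcd]; first by rewrite inJ.
  (* No value is skipped: j is at most the letter d, and the letters of a Cayley permutation are
     closed downwards. *)
  have /mem_word[k ek] : (j : nat) \in word w.
    have dw : (d : nat) \in word w by apply/mem_word; exists di; rewrite ed.
    by case/andP: jcd => _; rewrite leq_eqVlt => /predU1P[-> //|]; apply: cw.
  by exists k; [rewrite -inJ -ek | apply: val_inj].
by rewrite inE [LHS]intP inJ.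
Qed.

Lemma card_interval1 n (a b : 'I_n) : a <= b -> (#|Defs.interval a b| == 1) = (a == b).
Proof.
move=> ab; apply/cards1P/eqP => [[x e] | ->].
  have : a \in Defs.interval a b by rewrite inE leqnn.
  have : b \in Defs.interval a b by rewrite inE leqnn ab.
  by rewrite e !inE => /eqP-> /eqP->.
by exists b; apply/setP => i; rewrite !inE -val_eqE eqn_leq andbC.
Qed.

Lemma simple_word n (w : {ffun 'I_n -> 'I_n}) :
  w \in Cay n -> simple_cay w = simple (word w).
Proof.
move=> wC; apply/forallP/simpleP => [S i k | S I].
  rewrite size_word => ik H; have i_n : i < n by lia.
  (* [interval] is closed whereas [hint] is half-open, hence the right end k - 1. *)
  have k_n : k.-1 < n by lia.
  have := S (Defs.interval (Ordinal i_n) (Ordinal k_n)); rewrite H_interval_word //=; last by lia.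
  rewrite prednK; last by lia.
  rewrite (introT (hintP _) H) /=; last by rewrite size_word; lia.
  case/orP=> [|/eqP/setP e]; first by rewrite card_interval1 -?val_eqE /=; lia.
  have n0 : 0 < n by lia.
  have n1 : n.-1 < n by lia.
  right; have := e (Ordinal n0); have := e (Ordinal n1); rewrite !inE /=; lia.
apply/implyP => HI; have /and3P[I0 /existsP[a /existsP[b /eqP e]] _] := HI.
have ab : a <= b by case/set0Pn: I0 => i; rewrite e inE; lia.
rewrite e H_interval_word // in HI; have bn := ltn_ord b.
have [||eb|[ea eb]] := S a b.+1.
- by rewrite size_word; lia.
- by apply/hintP: HI; rewrite size_word; lia.
- by rewrite e card_interval1 // -val_eqE /=; case: eb => ->; rewrite eqxx.
apply/orP; right; rewrite e; apply/eqP/setP => i; rewrite !inE.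
by have := ltn_ord i; rewrite size_word in eb; lia.
Qed.

(** * Generating functions *)

Section Series.
Import GRing.Theory.
Local Open Scope ring_scope.

(** Monotonicity and simplicity only depend on comparisons between letters, which standardization
    preserves. *)
Lemma wt_std s : wt (std s) = wt s.
Proof.
have nthE i j : (i < size s)%N -> (j < size s)%N ->
    (nth 0 (std s) i < nth 0 (std s) j)%N = (nth 0 s i < nth 0 s j)%N.
  move=> i_s j_s; rewrite !(nth_map 0%N) //.
  have := @rank_lt s (nth 0%N s i) (nth 0%N s j) (mem_nth 0%N i_s).
  have := @rank_le s (nth 0%N s j) (nth 0%N s i); lia.
have monoE : mono (std s) = mono s.
  rewrite -[in LHS](seg_full (std s)) -[in RHS](seg_full s) size_std.
  by apply/monoP/monoP; rewrite ?size_std // => -[M|M]; [left|right|left|right];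
    move=> j l j0 jl ls; have := M j l j0 jl ls; rewrite nthE //; lia.
have hintpE i k : (k <= size s)%N -> hintp (std s) i k <-> hintp s i k.
  move=> ks; split=> H j jn jik; rewrite ?size_std in jn *.
    by have [||r|r] := H j; rewrite ?size_std //; [left|right] => l lk;
      have := r l lk; rewrite nthE //; lia.
  by have [||r|r] := H j; rewrite ?size_std //; [left|right] => l lk;
    have := r l lk; rewrite nthE //; lia.
rewrite /wt monoE size_std; case: ifP => // _; congr (if _ then _ else _).
apply/simpleP/simpleP; rewrite ?size_std => S i k ik H; apply: S => //; apply/hintpE => //; lia.
Qed.

Lemma cayw1 : cayw 1 = [:: [:: 0%N]].
Proof.
apply: perm_small_eq => //; apply: uniq_perm; rewrite ?uniq_cayw // => p.
rewrite mem_cayw inE; apply/andP/eqP => [[/eqP sp cp]|-> //].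
case: p sp cp => [|v []] // _ cp.
by have := cay_bound cp (mem_head _ _); case: v cp.
Qed.

Definition upto (n : nat) : seq (seq nat) := [seq p | i <- iota 1 n, p <- cayw i].

Lemma mem_upto n p : (p \in upto n) = cay p && (0 < size p <= n)%N.
Proof.
apply/allpairsPdep/idP => [[i [q [iI qI ->]]] | /andP[cp sp]].
  by move: iI qI; rewrite mem_iota mem_cayw => iI /andP[/eqP-> ->]; lia.
exists (size p), p; split; rewrite ?mem_cayw ?eqxx // mem_iota; lia.
Qed.

Lemma uniq_upto n : uniq (upto n).
Proof.
apply: allpairs_uniq_dep => [|i _|[i p] [j q]]; [exact: iota_uniq|exact: uniq_cayw|].
move=> /allpairsPdep[i' [p' [_ pI [-> ->]]]] /allpairsPdep[j' [q' [_ qI [-> ->]]]] /= e.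
by move: pI qI; rewrite !mem_cayw e => /andP[/eqP<- _] /andP[/eqP<- _].
Qed.

Lemma sum_upto n (F : seq nat -> int) :
  \sum_(p <- upto n) F p = \sum_(i < n) \sum_(p <- cayw i.+1) F p.
Proof.
by rewrite big_allpairs_dep (iotaDl 1 0) big_map -{1}(subn0 n) big_mkord.
Qed.

Fixpoint fillings (k n : nat) : seq (seq (seq nat)) :=
  if k is k'.+1 then [seq p :: ps | p <- upto n, ps <- fillings k' (n - size p)]
  else if n == 0%N then [:: [::]] else [::].

Lemma mem_fillings k n ps : (ps \in fillings k n) =
  [&& size ps == k, all cay ps, [::] \notin ps & sumn (shape ps) == n].
Proof.
elim: k n ps => [|k IHk] n ps.
  by case: n => [|n]; case: ps => [|p ps]; rewrite ?inE ?andbF.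
apply/allpairsPdep/idP => [[p [ps' [pI psI ->]]] | ].
  move: pI psI; rewrite mem_upto IHk => /andP[cp sp] /and4P[/eqP <- cps n0 /eqP e].
  rewrite /= cp cps eqxx inE negb_or n0 e subnKC ?eqxx ?andbT; last by case/andP: sp.
  by case: (p) sp.
case: ps => //= p ps /and4P[/eqP[sk] /andP[cp cps]]; rewrite inE negb_or => /andP[p0 n0] /eqP<-.
exists p, ps; rewrite mem_upto IHk sk cp cps n0 addKn !eqxx; split=> //.
by rewrite leq_addr andbT; case: (p) p0.
Qed.

Lemma uniq_fillings k n : uniq (fillings k n).
Proof.
elim: k n => [|k IHk] n /=; first by case: eqP.
apply: allpairs_uniq_dep => [|p _|[p ps] [q qs] _ _ [-> ->]] //; exact: uniq_upto.
Qed.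

Definition class_series (f : seq nat -> int) : {fps int} :=
  Fps (fun m => if m == 0%N then 0 else \sum_(p <- cayw m) f p).

(** Iterated Cauchy product: one nonempty pattern is chosen per factor, with total length n. The
    zero constant terms rule out empty patterns. *)
Lemma coef_prod_class (wl : nat -> seq nat -> int) cs n :
  (\prod_(c <- cs) class_series (wl c)) n =
  \sum_(ps <- fillings (size cs) n) \prod_(cp <- zip cs ps) wl cp.1 cp.2.
Proof.
elim: cs n => [|c cs IHcs] n.
  by rewrite big_nil fps_coef1 /=; case: eqP => _; rewrite ?big_seq1 ?big_nil.
rewrite big_cons fps_coefM big_ord_recl [class_series _ _]/= mul0r add0r.
rewrite [fillings _ _]/= big_allpairs_dep sum_upto; apply: eq_bigr => i _ /=.
rewrite mulr_suml; apply: eq_big_seq => p; rewrite mem_cayw => /andP[/eqP-> _].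
by rewrite IHcs mulr_sumr; apply: eq_bigr => ps _; rewrite big_cons.
Qed.

(* The series V with B(x, V) = x: an inflatable letter of a Cayley permutation
   contributes x V, i.e. it is replaced by a signed H-interval. *)
Definition Vseries : {fps int} := Fps (fun m => \sum_(p <- cayw m.+1) wt p).

Definition letter_wt (o : seq nat) (c : nat) (p : seq nat) : int :=
  if count_mem c o == 1%N then wt p else (p == [:: 0%N])%:R.

Lemma fps_coefXM (f : {fps int}) n : (fpsX * f) n = if n is n'.+1 then f n' else 0.
Proof.
rewrite fps_coefM; case: n => [|n]; first by rewrite big_ord1 mul0r.
rewrite big_ord_recl mul0r add0r big_ord_recl mul1r big1 ?addr0 /bump /= ?subSS ?subn0 //.
by move=> i _; rewrite mul0r.
Qed.

Lemma fps_coefXnM (f : {fps int}) k n :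
  (fpsX ^+ k * f) n = if (k <= n)%N then f (n - k)%N else 0.
Proof.
elim: k n => [|k IHk] n; first by rewrite expr0 mul1r subn0.
by rewrite exprS -mulrA fps_coefXM; case: n => // n; rewrite IHk ltnS subSS.
Qed.

Lemma class_series_letter o c : class_series (letter_wt o c) =
  if count_mem c o == 1%N then fpsX * Vseries else fpsX.
Proof.
apply: fpsP => m; rewrite /letter_wt; case: ifP => _.
  by rewrite fps_coefXM; case: m.
rewrite /=; case: eqP => [-> //|/eqP m0].
have [->|m1] := eqVneq m 1%N; first by rewrite cayw1 big_seq1 eqxx.
rewrite big1_seq // => p; rewrite mem_cayw => /andP[_ /andP[/eqP sp _]].
by case: eqP => // ep; move: m1; rewrite -sp ep.
Qed.

Lemma prod_class_series o : \prod_(c <- o) class_series (letter_wt o c) =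
  fpsX ^+ size o * Vseries ^+ count (fun c => count_mem c o == 1%N) o.
Proof.
rewrite (eq_bigr (fun c => fpsX * Vseries ^+ (count_mem c o == 1%N))); last first.
  by move=> c _; rewrite class_series_letter; case: eqP => _; rewrite ?expr1 ?mulr1.
elim: {1 3 5}o => [|c cs IHcs]; first by rewrite big_nil mulr1.
by rewrite big_cons IHcs /= exprS exprD; ring.
Qed.

Lemma fps_coef_sum (I : Type) (r : seq I) (P : pred I) (F : I -> {fps int}) n :
  (\sum_(i <- r | P i) F i) n = \sum_(i <- r | P i) F i n.
Proof.
exact: (big_morph (fun f : {fps int} => f n) (fun f g => fps_coefD f g n) (fps_coef0 _ n)).
Qed.

Lemma Bseries_horner k (U : {fps int}) : (map_poly intr (Bseries k)).[U] =
  if k == 0%N then 0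
  else \sum_(o <- cayw k) U ^+ count (fun c => count_mem c o == 1%N) o.
Proof.
rewrite /Bseries /=; case: ifP => _; first by rewrite raddf0 horner0.
rewrite rmorph_sum horner_sum big_map big_enum; apply: eq_bigr => w _ /=.
by rewrite map_polyXn hornerXn mu_word.
Qed.

Definition inflations (n : nat) : seq (seq nat * seq (seq nat)) :=
  [seq (o, ps) | o <- upto n, ps <- fillings (size o) n].

Definition all_splits (n : nat) : seq (seq (seq nat)) :=
  [seq ss | t <- cayw n, ss <- splits n t].

(** The term of [o] in B(x, V) is a product with one factor per letter; expanding it chooses a
    pattern for each letter, and choices that are not inflatable contain a zero factor. *)
Lemma coef_subst_V n : fps_subst Bseries Vseries n =
  \sum_(op <- inflations n | inflatable op.1 op.2) \prod_(p <- op.2) wt p.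
Proof.
rewrite [LHS]big_ord_recl Bseries_horner mulr0 fps_coef0 add0r.
rewrite [RHS]big_mkcond big_allpairs_dep sum_upto; apply: eq_bigr => k _.
rewrite Bseries_horner lift0 mulr_sumr fps_coef_sum.
apply: eq_big_seq => o; rewrite mem_cayw => /andP[/eqP so co].
rewrite -[k.+1 in LHS]so -prod_class_series coef_prod_class.
apply: eq_big_seq => ps; rewrite mem_fillings => /and4P[/eqP sps _ _ _].
have -> : \prod_(p <- ps) wt p = \prod_(cp <- zip o ps) wt cp.2.
  by rewrite -{1}(@unzip2_zip _ _ o ps) ?sps // big_map.
rewrite /inflatable /=.
case: ifP => [/allP H|/negbT/allPn[cp cpI H]].
  apply: eq_big_seq => cp cpI; have := H _ cpI; rewrite /letter_wt.
  by case: ifP => //= _ /eqP->; rewrite eqxx.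
rewrite (big_rem cp) //= (_ : letter_wt _ _ _ = 0) ?mul0r //.
by move: H; rewrite negb_or /letter_wt => /andP[/negPf-> /negPf->].
Qed.

Lemma mem_all_splits n ss : (ss \in all_splits n) =
  [&& [::] \notin ss, cay (flatten ss) & size (flatten ss) == n].
Proof.
apply/allpairsPdep/idP => [[t [ss' [tI ssI ->]]] | /and3P[n0 c /eqP s]].
  move: tI; rewrite mem_cayw => /andP[/eqP st ct]; move: ssI.
  by rewrite mem_splits ?st // => /andP[/eqP-> ->]; rewrite ct st eqxx.
exists (flatten ss), ss; split=> //; first by rewrite mem_cayw s c eqxx.
by rewrite mem_splits ?s // n0 eqxx.
Qed.

Lemma uniq_all_splits n : uniq (all_splits n).
Proof.
apply: allpairs_uniq_dep => [|t _|[t ss] [t' ss']]; [exact: uniq_cayw|exact: uniq_splits|].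
move=> /allpairsPdep[t1 [ss1 [tI sI [-> ->]]]] /allpairsPdep[t2 [ss2 [tI' sI' [-> ->]]]] /= e.
move: tI tI' sI sI'; rewrite !mem_cayw => /andP[/eqP s1 _] /andP[/eqP s2 _].
by rewrite !mem_splits ?s1 ?s2 // e => /andP[/eqP<- _] /andP[/eqP<- _].
Qed.

Lemma uniq_inflations n : uniq (inflations n).
Proof.
apply: allpairs_uniq_dep => [|o _|[o ps] [o' ps'] _ _ [-> ->]] //.
  exact: uniq_upto.
exact: uniq_fillings.
Qed.

Lemma size_le_flatten (ss : seq (seq nat)) : [::] \notin ss -> (size ss <= size (flatten ss))%N.
Proof.
elim: ss => //= s ss IHss; rewrite inE negb_or size_cat => /andP[s0 /IHss].
by case: s s0 => //= x s _; lia.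
Qed.

Lemma size_mem_flatten (ss : seq (seq nat)) s : s \in ss -> (size s <= size (flatten ss))%N.
Proof.
elim: ss => //= r ss IHss; rewrite inE size_cat => /predU1P[-> | /IHss]; first exact: leq_addr.
by move=> /leq_trans; apply; apply: leq_addl.
Qed.

Lemma mem_inflations n o ps : ((o, ps) \in inflations n) =
  [&& cay o, (0 < size o <= n)%N, size ps == size o, all cay ps, [::] \notin ps &
    sumn (shape ps) == n].
Proof.
apply/allpairsPdep/idP => [[o' [ps' [oI pI [-> ->]]]] | /and3P[co so pI]].
  by move: oI pI; rewrite mem_upto mem_fillings => /andP[-> ->] ->.
by exists o, ps; split=> //; rewrite ?mem_upto ?mem_fillings ?co.
Qed.

(** [decompose] is a bijection with inverse [inflation]. The base N = n + 1 exceeds all block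
    lengths and all pattern letters. *)
Lemma perm_decompose n : (0 < n)%N ->
  perm_eq [seq decompose ss | ss <- all_splits n & tiling ss]
    [seq op <- inflations n | inflatable op.1 op.2].
Proof.
move=> n0; have small ss : size (flatten ss) = n -> all (fun s : seq nat => size s < n.+1)%N ss.
  by move=> <-; apply/allP => s sI; rewrite ltnS size_mem_flatten.
apply: uniq_perm.
- rewrite map_inj_in_uniq ?filter_uniq ?uniq_all_splits // => ss ss'.
  rewrite !mem_filter !mem_all_splits.
  move=> /andP[T /and3P[z c /eqP /small b]] /andP[T' /and3P[z' c' /eqP /small b']].
  exact: (decompose_inj T z b c T' z' b' c').
- by rewrite filter_uniq ?uniq_inflations.
move=> [o ps]; rewrite mem_filter; apply/mapP/andP => [[ss] | []] /=.
  rewrite mem_filter mem_all_splits => /andP[T /and3P[z c /eqP sn]] e.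
  have -> : o = (decompose ss).1 by rewrite -e.
  have -> : ps = (decompose ss).2 by rewrite -e.
  split; first exact: (decompose_inflatable T z (small _ sn)).
  rewrite mem_inflations /= /quotient_word cay_std size_std !size_map eqxx -sn size_le_flatten //.
  have shE : shape (map std ss) = shape ss.
    by rewrite /shape -map_comp; apply: eq_map => s; rewrite /= size_std.
  rewrite shE -size_flatten eqxx andbT /= andbT; apply/and3P; split.
  - by case: (ss) sn n0 => //= <-.
  - by apply/allP => _ /mapP[s _ ->]; apply: cay_std.
  - apply/negP => /mapP[s sI e0]; case/negP: z; rewrite (_ : [::] = s) //.
    by apply/esym/nilP; rewrite /nilp -size_std -e0.
move=> oP; rewrite mem_inflations => /and5P[co so /eqP/esym sop cps /andP[z /eqP sn]].
have psN : all (all (gtn n.+1)) ps.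
  apply/allP => p pI; apply/allP => v vp /=; rewrite ltnS.
  apply: leq_trans (ltnW (cay_bound (allP cps _ pI) vp)) _.
  by rewrite -sn -size_flatten size_mem_flatten.
exists (inflation n.+1 o ps); last by rewrite decompose_inflation.
rewrite mem_filter inflation_tiling // mem_all_splits inflation_neq0 //.
by rewrite inflation_flatten // cay_std -inflation_flatten // size_flatten
  inflation_shape // sn eqxx.
Qed.

Lemma subst_V : fps_subst Bseries Vseries = fpsX.
Proof.
apply: fpsP => n; rewrite coef_subst_V; have [->|n0] := posnP n; first by rewrite big_nil.
rewrite -big_filter -(perm_big _ (perm_decompose n0)) /= big_map big_filter.
rewrite big_mkcond big_allpairs_dep /=.
(* The tilings are grouped by the word t they tile; patterns weigh as much as their blocks, so
   [sum_tilings] applies to each t. *)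
rewrite (eq_big_seq (fun _ => (n == 1%N)%:R)) => [|t]; last first.
  rewrite mem_cayw => /andP[/eqP st _]; rewrite -{2}st -sum_tilings ?st // -big_mkcond.
  by apply: eq_bigr => ss _; rewrite big_map; apply: eq_bigr => s _; rewrite wt_std.
have [->|n1] := eqVneq n 1%N; [by rewrite cayw1 big_seq1 | by rewrite big1].
Qed.

End Series.

(** * Uniqueness of the solution U *)

Section Uniqueness.
Import GRing.Theory.
Local Open Scope ring_scope.
Local Notation agree m U U' := (forall j, (j <= m)%N -> fps_coef U j = fps_coef U' j).

Lemma agreeM m (F F' G G' : {fps int}) :
  agree m F F' -> agree m G G' -> agree m (F * G) (F' * G').
Proof.
move=> FF GG j jm; rewrite !fps_coefM; apply: eq_bigr => i _.
by rewrite FF ?GG //; have := ltn_ord i; lia.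
Qed.

Lemma agreeX m (F F' : {fps int}) k : agree m F F' -> agree m (F ^+ k) (F' ^+ k).
Proof. by move=> FF; elim: k => [//|k IHk]; rewrite !exprS; apply: agreeM. Qed.

Lemma agree_Bseries m k (U U' : {fps int}) : agree m U U' ->
  agree m (map_poly intr (Bseries k)).[U] (map_poly intr (Bseries k)).[U'].
Proof.
move=> UU j jm; rewrite !Bseries_horner; case: ifP => // _.
by rewrite !fps_coef_sum; apply: eq_bigr => o _; apply: (agreeX _ UU).
Qed.

(** Since B_1(t) = t, the coefficient of x^(n+1) in B(x, U) is U_n plus terms of order at least 2 in
    x, which involve only coefficients of U of index below n. *)
Lemma fps_subst_inj (U U' : {fps int}) :
  fps_subst Bseries U = fps_subst Bseries U' -> U = U'.
Proof.
move=> e; apply: fpsP => n; elim/ltn_ind: n => n IHn.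
have step (W : {fps int}) : fps_subst Bseries W n.+1 = W n +
    \sum_(k < n) (fpsX ^+ k.+2 * (map_poly intr (Bseries k.+2)).[W]) n.+1.
  rewrite [LHS]big_ord_recl Bseries_horner mulr0 fps_coef0 add0r big_ord_recl.
  have B1 : (map_poly intr (Bseries 1)).[W] = W.
    by rewrite Bseries_horner cayw1 big_seq1 expr1.
  by congr (_ + _); rewrite lift0 B1 expr1 fps_coefXM.
have := congr1 (fun f : {fps int} => f n.+1) e; rewrite !step.
rewrite [X in _ = _ + X](eq_bigr
  (fun k : 'I_n => (fpsX ^+ k.+2 * (map_poly intr (Bseries k.+2)).[U]) n.+1)).
  by move/addIr.
move=> k _; rewrite !fps_coefXnM; case: ifP => // kn.
apply/esym/(@agree_Bseries (n.+1 - k.+2)) => // j jk; apply: IHn; lia.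
Qed.

End Uniqueness.

(** * Counting simple Cayley permutations *)

Section Counting.
Import GRing.Theory.
Local Open Scope ring_scope.

(** The first two letters of a monotone word form an H-interval. *)
Lemma mono_simple p : mono p -> (1 < size p)%N -> simple p = (size p == 2)%N.
Proof.
rewrite -{1}(seg_full p) => /monoP M p1; have {}M := M (leqnn _).
apply/simpleP/eqP => [S | p2 i k]; last by rewrite p2; lia.
have H : hintp p 0 2 by apply: (hintp_mono (@hintp_full p) M).
by have [|//||[]] := S 0%N 2%N.
Qed.

(** The letters are distinct and below the length, so all values below the length occur. *)
Lemma sorted_cay p : cay p -> sorted ltn p -> p = iota 0 (size p).
Proof.
move=> cp sp; apply: (irr_sorted_eq ltn_trans ltnn) => //; first exact: iota_ltn_sorted.
have up : uniq p by apply: (sorted_uniq ltn_trans ltnn).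
have sub : {subset p <= iota 0 (size p)}.
  by move=> v vp; rewrite mem_iota /= add0n cay_bound.
by have [] := uniq_min_size up sub; rewrite ?size_iota.
Qed.

Lemma cay_iota n : cay (iota 0 n).
Proof.
apply/cayP => u v; rewrite !mem_iota /= !add0n => vn uv; exact: ltn_trans vn.
Qed.

Lemma count_mono n : (1 < n)%N -> count mono (cayw n) = 2%N.
Proof.
move=> n1; rewrite -size_filter.
have -> : 2%N = size [:: iota 0 n; rev (iota 0 n)] by [].
have iota_sorted : sorted ltn (iota 0 n) by apply: iota_ltn_sorted.
apply/perm_size/uniq_perm; rewrite ?filter_uniq ?uniq_cayw //= ?andbT.
  rewrite inE; apply/eqP => /(congr1 (nth 0%N ^~ 0%N)).
  by rewrite nth_rev ?size_iota ?nth_iota //; lia.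
have cay_rev p : cay (rev p) = cay p.
  by apply/cayP/cayP => H u v; have := H u v; rewrite !mem_rev.
move=> p; rewrite mem_filter mem_cayw !inE; apply/andP/orP.
  move=> [/orP[s|s] /andP[/eqP <- c]]; [left|right]; apply/eqP.
    exact: sorted_cay.
  by rewrite -(size_rev p) -sorted_cay ?revK ?cay_rev // rev_sorted.
case=> /eqP->; rewrite ?cay_rev cay_iota ?size_rev size_iota eqxx /mono; split=> //.
  by rewrite iota_sorted.
by rewrite [X in _ || X]rev_sorted iota_sorted orbT.
Qed.

Lemma nb_simple_sum n : (nb_simple n)%:Z = \sum_(p <- cayw n) (simple p)%:R.
Proof.
rewrite /nb_simple -natz -sum1_card natr_sum big_map big_enum /= big_mkcond [RHS]big_mkcond /=.
apply: eq_bigr => w _; rewrite in_set; case wC: (w \in Cay n) => //=.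
by rewrite simple_word //; case: (simple _).
Qed.

Definition cube_div : {fps int} := Fps (fun n => if (n < 3)%N then 0 else (-1) ^+ n.+1).

Lemma cube_divE : fpsX ^+ 3 / (1 + fpsX) = cube_div.
Proof.
have u : (1 + fpsX : {fps int}) \is a GRing.unit.
  by rewrite fps_unitE fps_coefD fps_coef1 /= addr0 unitr1.
apply: (mulIr u); rewrite divrK // mulrDr mulr1 [cube_div * _]mulrC -[LHS]mulr1.
apply: fpsP => n; rewrite fps_coefD fps_coefXM fps_coefXnM fps_coef1.
case: n => [|[|[|[|n]]]] //=.
by rewrite [_ ^+ n.+1.+4]exprS mulN1r addNr.
Qed.

Lemma simple_count_formula : Sseries + fpsX * Vseries = 2 * fpsX + 2 * cube_div.
Proof.
have twoE (f : {fps int}) n : (2 * f) n = f n *+ 2.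
  by rewrite mulr_natl mulr2n fps_coefD.
apply: fpsP => n; rewrite !fps_coefD !twoE fps_coefXM.
case: n => [//|n]; rewrite [Sseries _]/= [Vseries _]/= nb_simple_sum -big_split /=.
have [->|n0] := posnP n; first by rewrite cayw1 big_seq1.
have -> : (n.+1 == 1%N) = false by lia.
(* From length 2 on, a non-monotone word adds as much to S as it removes through V, so only the two
   monotone words contribute. *)
rewrite (eq_big_seq (fun p => if mono p then (n.+1 == 2)%:R + (-1) ^+ n else 0)).
  rewrite -big_mkcond big_const_seq count_mono // /= !addr0.
  case: n n0 => [//|[|n]] _; first by [].
  by rewrite /= !exprS; ring.
move=> p; rewrite mem_cayw => /andP[/eqP sp cp]; rewrite /wt.
case: ifP => [M|_]; first by rewrite mono_simple // ?sp.
by case: (simple p); rewrite ?addrN ?addr0.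
Qed.

End Counting.

Local Open Scope ring_scope.

Theorem corollary4p7 :
  (exists! U : {fps int}, fps_subst Bseries U = fpsX) /\
  (forall U : {fps int}, fps_subst Bseries U = fpsX ->
     Sseries = 2 * fpsX + 2 * fpsX ^+ 3 / (1 + fpsX) - fpsX * U).
Proof.
have Uniq (U : {fps int}) : fps_subst Bseries U = fpsX -> Vseries = U.
  by rewrite -subst_V => /esym/fps_subst_inj.
split; first by exists Vseries; split; [exact: subst_V | exact: Uniq].
move=> U /Uniq <-; rewrite -GRing.mulrA cube_divE -simple_count_formula.
by rewrite GRing.addrK.
Qed.
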